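(* Let $a_0,\epsilon,\nu>0$, let $c_{\mathrm{change}}>0$, let $c_{\mathrm{lower}}:[0,\infty)\to(0,\infty)$ be a decreasing function and $c_{\mathrm{upper}}:[0,\infty)\to(0,\infty)$ an increasing function. Then there exist constants $C_{\mathrm{false}},C_{\mathrm{dim}},C_{\mathrm{sample},1},C_{\mathrm{sample},2}>0$, depending only on $(c_{\mathrm{change}},c_{\mathrm{lower}}(a_0),c_{\mathrm{upper}}(a_0))$ and on $(\epsilon,\nu)$, such that the following holds for all integers $n,p\ge2$ and $q\ge1$. Let $\beta_0\in\mathbb{R}^p$ be the true parameter of the logistic regression model, with $J_0=\mathrm{supp}(\beta_0)$, $|J_0|\le q$ and $\|\beta_0\|_2\le a_0$. Condition on values of the covariates $X_1,\dots,X_n\in\mathbb{R}^p$ such that for all $J\subseteq[p]$ with $J\supseteq J_0$ and $|J|\le 2q$ and for all $\beta,\beta'\in\mathbb{R}^J$, $$c_{\mathrm{lower}}(\|\beta\|_2)\,\mathbf{I}_J\preceq \tfrac1n H_J(\beta)\preceq c_{\mathrm{upper}}(\|\beta\|_2)\,\mathbf{I}_J\quad\text{and}\quad \tfrac1n\|H_J(\beta)-H_J(\beta')\|\le c_{\mathrm{change}}\|\beta-\beta'\|_2 .$$ If $$p\ge C_{\mathrm{dim}}\quad\text{and}\quad n\ge\max\Big\{C_{\mathrm{sample},1}\cdot q^3\log(p),\; C_{\mathrm{sample},2}\cdot\frac{q\log(p)}{\min_{j\in J_0}|(\beta_0)_j|^2}\Big\},$$ then the following two statements hold simultaneously with conditional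 probability (given $X_1,\dots,X_n$) at least $1-p^{-\nu}$: (a) for all $J\subseteq[p]$ with $|J|\le q$ and $J\supseteq J_0$, $$\log \mathrm{L}(\hat\beta_J)-\log \mathrm{L}(\hat\beta_{J_0})\le(1+\epsilon)(|J\setminus J_0|+\nu)\log(p);$$ (b) for all $J\subseteq[p]$ with $|J|\le q$ and $J\not\supseteq J_0$, $$\log \mathrm{L}(\hat\beta_{J_0})-\log \mathrm{L}(\hat\beta_J)\ge C_{\mathrm{false}}\; n\min_{j\in J_0}|(\beta_0)_j|^2 .$$
   Context: $[p]=\{1,\dots,p\}$ and $\mathrm{supp}(\beta_0)=\{j:(\beta_0)_j\ne0\}$. Logistic regression model: conditional on covariates $X_1,\dots,X_n\in\mathbb{R}^p$, the responses $Y_1,\dots,Y_n\in\{0,1\}$ are independent with $\log\frac{P(Y_i=1\mid X_i)}{1-P(Y_i=1\mid X_i)}=X_i^\top\beta_0$. With $\mathrm{b}(\theta)=\log(1+e^\theta)$, the log-likelihood is $\log \mathrm{L}(\beta)=\sum_{i=1}^n\big(Y_i\,X_i^\top\beta-\mathrm{b}(X_i^\top\beta)\big)$ and the negative Hessian is $H(\beta)=\sum_{i=1}^n X_iX_i^\top\mathrm{b}''(X_i^\top\beta)$, where $\mathrm{b}''(\theta)=e^\theta/(1+e^\theta)^2$. For $J\subseteq[p]$, a vector $\beta\in\mathbb{R}^J$ (indexed by $J$) is identified with the vector in $\mathbb{R}^p$ obtained by filling in zeros outside $J$; $H_J(\beta)$ is the $J\times J$ submatrix of $H(\beta)$; $\mathbf{I}_J$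 is the $J\times J$ identity. $\hat\beta_J$ is the maximum likelihood estimator in the model given by $J$, i.e. a maximizer of $\log\mathrm{L}$ over $\mathbb{R}^J$ (so $\log\mathrm{L}(\hat\beta_J)$ is the supremum of $\log \mathrm{L}$ over $\mathbb{R}^J$). $\|\cdot\|$ is the spectral norm and $A\preceq B$ means $B-A$ is positive semidefinite. If $J_0=\emptyset$, the minimum over $J_0$ is read as $+\infty$ (the corresponding sample size requirement and part (b) are then vacuous). *)

(* Defs.v *)
From HB Require Import structures.
From mathcomp Require Import all_boot all_order all_algebra.
From mathcomp Require Import all_classical all_reals all_analysis.

Set Implicit Arguments.
Unset Strict Implicit.
Unset Printing Implicit Defensive.
Import Order.TTheory GRing.Theory Num.Theory.
Local Open Scope classical_set_scope.
Local Open Scope ring_scope.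

Section linear_algebra.
Context {R : realType}.

Definition dotp m (u v : 'cV[R]_m) : R := \sum_(i < m) u i 0 * v i 0.

Definition norm2 m (v : 'cV[R]_m) : R := Num.sqrt (dotp v v).

Definition spectral_norm m (A : 'M[R]_m) : R :=
  sup [set norm2 (A *m v) | v in [set v | norm2 v <= 1]].

Definition psd m (A : 'M[R]_m) : Prop :=
  A^T = A /\ forall v : 'cV[R]_m, 0 <= dotp v (A *m v).

Definition loewner_le m (A B : 'M[R]_m) : Prop := psd (B - A).

Definition supp p (beta : 'cV[R]_p) : {set 'I_p} := [set j | beta j 0 != 0].

(* Vectors of R^J are represented by their zero-filled extensions to R^p. *)
Definition supported p (J : {set 'I_p}) : set 'cV[R]_p :=
  [set beta | supp beta \subset J].

Definition principal_submx p (J : {set 'I_p}) (A : 'M[R]_p) : 'M[R]_#|J| :=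
  mxsub enum_val enum_val A.

(* Equal to +oo when beta = 0. *)
Definition min_signal p (beta : 'cV[R]_p) : \bar R :=
  \big[mine/+oo%E]_(j in supp beta) (`|beta j 0| ^+ 2)%:E.

End linear_algebra.

Section logistic_regression.
Context {R : realType}.

Definition cumulant (t : R) : R := ln (1 + expR t).

(* The second derivative of cumulant. *)
Definition cumulant2 (t : R) : R := expR t / (1 + expR t) ^+ 2.

Section likelihood.
Variables (n p : nat) (X : 'I_n -> 'cV[R]_p).

Definition loglik (y : 'I_n -> bool) (beta : 'cV[R]_p) : R :=
  \sum_(i < n) ((y i)%:R * dotp (X i) beta - cumulant (dotp (X i) beta)).

Definition neg_hessian (beta : 'cV[R]_p) : 'M[R]_p :=
  \sum_(i < n) cumulant2 (dotp (X i) beta) *: (X i *m (X i)^T).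

Definition is_mle (y : 'I_n -> bool) (J : {set 'I_p}) (b : 'cV[R]_p) : Prop :=
  supported J b /\ forall beta, supported J beta -> loglik y beta <= loglik y b.

(* The maximized log-likelihood of the model J.  The supremum is finite
   (maxloglik_has_sup) even for separable data, for which no maximizer exists;
   if there is one, its log-likelihood is the supremum (maxloglik_mle). *)
Definition maxloglik (y : 'I_n -> bool) (J : {set 'I_p}) : R :=
  sup [set loglik y beta | beta in supported J].

Lemma loglik_le0 y beta : loglik y beta <= 0.
Proof.
apply: sumr_le0 => i _; rewrite subr_le0 /cumulant.
set t := dotp _ _; have e0 := expR_gt0 t.
case: (y i); rewrite ?mul1r ?mul0r.
  by rewrite -[leLHS]expRK ler_ln ?posrE ?addr_gt0 // lerDr.
by apply: ln_ge0; rewrite lerDl ltW.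
Qed.

Lemma maxloglik_has_sup y J : has_sup [set loglik y beta | beta in supported J].
Proof.
split; last by exists 0 => _ [beta _ <-]; exact: loglik_le0.
exists (loglik y 0), 0 => //=.
by apply/fintype.subsetP => j; rewrite inE mxE eqxx.
Qed.

Lemma maxloglik_mle y J b : is_mle y J b -> loglik y b = maxloglik y J.
Proof.
move=> [bJ bmax]; apply/eqP; rewrite eq_le; apply/andP; split.
  by apply: ub_le_sup; [case: (maxloglik_has_sup y J)|exists b].
by apply: ge_sup; [exists (loglik y b), b|move=> _ [beta /bmax ? <-]].
Qed.

End likelihood.

(* Joint independence of a finite family; taking some of the B i equal to setT
   gives the product rule for subfamilies. *)
Definition independent_responses d (T : measurableType d)
    (P : probability T R) n (Y : 'I_n -> {RV P >-> bool}) : Prop :=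
  forall B : 'I_n -> set bool,
    P (\bigcap_(i in [set: 'I_n]) (Y i @^-1` B i)) =
    (\prod_(i < n) P (Y i @^-1` B i))%E.

Definition success_prob d (T : measurableType d) (P : probability T R)
    (Y : {RV P >-> bool}) : R := fine (P (Y @^-1` [set true])).

(* P is the conditional law given the covariates X.  The bounds 0 < _ < 1 make
   the log-odds genuine: ln is 0 outside of the positive reals. *)
Definition logistic_model d (T : measurableType d) (P : probability T R) n p
    (X : 'I_n -> 'cV[R]_p) (beta0 : 'cV[R]_p) (Y : 'I_n -> {RV P >-> bool}) :
    Prop :=
  independent_responses Y /\
  forall i, 0 < success_prob (Y i) < 1 /\
    ln (success_prob (Y i) / (1 - success_prob (Y i))) = dotp (X i) beta0.

Definition hessian_conditions n p (X : 'I_n -> 'cV[R]_p) (q : nat)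
    (J0 : {set 'I_p}) (c_lower c_upper : R -> R) (c_change : R) : Prop :=
  forall J : {set 'I_p}, J0 \subset J -> (#|J| <= 2 * q)%N ->
  forall beta beta' : 'cV[R]_p, supported J beta -> supported J beta' ->
  let H b := principal_submx J (neg_hessian X b) in
  [/\ loewner_le (c_lower (norm2 beta))%:M (n%:R^-1 *: H beta),
      loewner_le (n%:R^-1 *: H beta) (c_upper (norm2 beta))%:M &
      n%:R^-1 * spectral_norm (H beta - H beta')
        <= c_change * norm2 (beta - beta')].

End logistic_regression.

(* Main.v *)
Require Import Defs.
From HB Require Import structures.
From mathcomp Require Import all_boot all_order all_algebra.
From mathcomp Require Import all_classical all_reals all_analysis.
From mathcomp Require Import ring lra.

Set Implicit Arguments.
Unset Strict Implicit.
Unset Printing Implicit Defensive.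
Import Order.TTheory GRing.Theory Num.Theory.
Import numFieldNormedType.Exports.
Local Open Scope classical_set_scope.
Local Open Scope ring_scope.

(* Given the covariates, a vector y of responses has probability exp (l(y, b)),
   where l is the log-likelihood and b the true parameter; these weights have
   total mass 1 for every parameter.  Writing S for the score at b,
   l(b + u) - l(b) = u.S - D(u), where D(u) is free of y and, by the Hessian
   conditions, is u^T H u / 2 up to n c |u|^3 / 2.  Mass 1 at b + u says that
   E exp(u.S) = exp(D(u)), so Chernoff's bound controls all linear forms of S.

   First, |S_j| <= A sqrt(n ln p) for all j.  Then D outgrows u.S outside of a
   ball of radius r = O(sqrt(q ln p / n)), by convexity.  Inside the ball, split
   u = a + v with a in R^J0 and v in the H-orthogonal complement V of R^J0 in
   R^J: the a-part is at most the gain of J0 itself, the v-part is at most half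
   the squared norm of the projection z of S on V, and the cubic errors are
   O(n r^3), negligible as n >> q^3 ln p.  The tail of |z|^2 is that of a chi
   square with |J \ J0| degrees of freedom, up to a factor C^|J \ J0| absorbed
   by a power of p; a union bound over J gives (a).

   For (b), b' in R^J is at distance at least the square root of the minimal
   signal mu from b, so D is of order n mu there and dominates u.S.  A radius
   proportional to sqrt(mu) stays in the region where the cubic error is
   controlled because mu <= 4 / cl: indeed t^2 exp(t) / (1 + exp(t))^2 <= 4. *)

(** * Euclidean geometry of coordinate subspaces *)

Section euclidean.
Context {R : realType}.

Section dot_product.
Variable m : nat.
Implicit Types (u v w : 'cV[R]_m) (a : R).

Lemma dotpE u v : dotp u v = (u^T *m v) 0 0.
Proof. by rewrite mxE; apply: eq_bigr => i _; rewrite mxE. Qed.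

Lemma dotpC u v : dotp u v = dotp v u.
Proof. by apply: eq_bigr => i _; rewrite mulrC. Qed.

Lemma dotpDr u v w : dotp u (v + w) = dotp u v + dotp u w.
Proof. by rewrite !dotpE mulmxDr mxE. Qed.

Lemma dotpZr a u v : dotp u (a *: v) = a * dotp u v.
Proof. by rewrite !dotpE -scalemxAr mxE. Qed.

Lemma dotpNr u v : dotp u (- v) = - dotp u v.
Proof. by rewrite -scaleN1r dotpZr mulN1r. Qed.

Lemma dotpBr u v w : dotp u (v - w) = dotp u v - dotp u w.
Proof. by rewrite dotpDr dotpNr. Qed.

Lemma dotp0r u : dotp u 0 = 0.
Proof. by rewrite !dotpE mulmx0 mxE. Qed.

Lemma dotpDl u v w : dotp (v + w) u = dotp v u + dotp w u.
Proof. by rewrite dotpC dotpDr !(dotpC u). Qed.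

Lemma dotpZl a u v : dotp (a *: v) u = a * dotp v u.
Proof. by rewrite dotpC dotpZr (dotpC u). Qed.

Lemma dotpBl u v w : dotp (v - w) u = dotp v u - dotp w u.
Proof. by rewrite dotpC dotpBr !(dotpC u). Qed.

Lemma dotp0l u : dotp 0 u = 0.
Proof. by rewrite dotpC dotp0r. Qed.

Lemma dotp_suml (I : finType) (F : I -> 'cV[R]_m) u :
  dotp (\sum_i F i) u = \sum_i dotp (F i) u.
Proof.
apply: (big_morph (fun v => dotp v u)) => [v w|]; first exact: dotpDl.
exact: dotp0l.
Qed.

Lemma dotp_sumr (I : finType) (F : I -> 'cV[R]_m) u :
  dotp u (\sum_i F i) = \sum_i dotp u (F i).
Proof. by rewrite dotpC dotp_suml; apply: eq_bigr => i _; exact: dotpC. Qed.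

Lemma dotp_ge0 u : 0 <= dotp u u.
Proof. by apply: sumr_ge0 => i _; rewrite -expr2 sqr_ge0. Qed.

Lemma dotp_eq0 u : dotp u u = 0 -> u = 0.
Proof.
move=> /eqP; rewrite psumr_eq0 => [/allP u0|i _]; last first.
  by rewrite -expr2 sqr_ge0.
apply/matrixP => i j; rewrite ord1 mxE; apply/eqP.
by have := u0 i (mem_index_enum _); rewrite mulf_eq0 orbb.
Qed.

Lemma cauchy_schwarz u v : dotp u v ^+ 2 <= dotp u u * dotp v v.
Proof.
have [v0|/eqP vn0] := eqVneq (dotp v v) 0.
  by rewrite (dotp_eq0 v0) !dotp0r expr0n mulr0.
have := dotp_ge0 (dotp v v *: u - dotp u v *: v).
have -> : dotp (dotp v v *: u - dotp u v *: v) (dotp v v *: u - dotp u v *: v)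
   = dotp v v * (dotp u u * dotp v v - dotp u v ^+ 2).
  by rewrite !(dotpBl, dotpBr, dotpZl, dotpZr) (dotpC v u); ring.
rewrite pmulr_rge0 ?subr_ge0 // lt_neqAle dotp_ge0 andbT eq_sym.
exact/eqP.
Qed.

Lemma norm2_ge0 u : 0 <= norm2 u. Proof. exact: sqrtr_ge0. Qed.

Lemma sqr_norm2 u : norm2 u ^+ 2 = dotp u u.
Proof. by rewrite sqr_sqrtr // dotp_ge0. Qed.

Lemma norm2Z a u : norm2 (a *: u) = `|a| * norm2 u.
Proof.
rewrite /norm2 dotpZl dotpZr mulrA -expr2 sqrtrM ?sqr_ge0 //.
by rewrite sqrtr_sqr.
Qed.

Lemma norm2_eq0 u : norm2 u = 0 -> u = 0.
Proof. by move=> u0; apply: dotp_eq0; rewrite -sqr_norm2 u0 expr0n. Qed.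

Lemma abs_dotp_le u v : `|dotp u v| <= norm2 u * norm2 v.
Proof.
rewrite -(@ler_pXn2r _ 2) ?nnegrE ?mulr_ge0 ?norm2_ge0 //.
by rewrite real_normK ?num_real // exprMn !sqr_norm2 cauchy_schwarz.
Qed.

Lemma norm2_coord u j : `|u j 0| <= norm2 u.
Proof.
rewrite -(@ler_pXn2r _ 2) ?nnegrE ?norm2_ge0 //.
rewrite real_normK ?num_real // sqr_norm2 /dotp (bigD1 j) //= expr2 lerDl.
by apply: sumr_ge0 => i _; rewrite -expr2 sqr_ge0.
Qed.

(** [spectral_norm] is a [sup], informative only for a bounded set; Cauchy-Schwarz on each row
    bounds it by the Frobenius norm. *)
Lemma mulmx_norm2_bound (A : 'M[R]_m) :
  exists K, forall v, norm2 v <= 1 -> norm2 (A *m v) <= K.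
Proof.
exists (Num.sqrt (\sum_i norm2 (row i A)^T ^+ 2)) => v v1.
rewrite ler_wsqrtr //; apply: ler_sum => i _.
have -> : (A *m v) i 0 = dotp (row i A)^T v.
  by rewrite mxE; apply: eq_bigr => k _; rewrite !mxE.
rewrite -expr2 -real_normK ?num_real // ler_pXn2r ?nnegrE ?norm2_ge0 //.
by rewrite (le_trans (abs_dotp_le _ _)) // ler_piMr ?norm2_ge0.
Qed.

Lemma norm2_mulmx_le (A : 'M[R]_m) v :
  norm2 (A *m v) <= spectral_norm A * norm2 v.
Proof.
have [K Kb] := mulmx_norm2_bound A.
have [v0|v0] := eqVneq (norm2 v) 0.
  by rewrite v0 (norm2_eq0 v0) mulmx0 mulr0 /norm2 dotp0r sqrtr0.
have nv : 0 < norm2 v by rewrite lt_neqAle eq_sym v0 norm2_ge0.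
have -> : norm2 (A *m v) = norm2 (A *m ((norm2 v)^-1 *: v)) * norm2 v.
  by rewrite -scalemxAr norm2Z gtr0_norm ?invr_gt0 // mulrAC mulVf ?mul1r.
rewrite ler_wpM2r ?norm2_ge0 //; apply: ub_le_sup.
  by exists K => _ [w w1 <-]; exact: Kb.
exists ((norm2 v)^-1 *: v) => //=.
by rewrite norm2Z gtr0_norm ?invr_gt0 // mulVf.
Qed.

Lemma quad_spectral_le (A : 'M[R]_m) v :
  `|dotp v (A *m v)| <= spectral_norm A * norm2 v ^+ 2.
Proof.
rewrite (le_trans (abs_dotp_le _ _)) // expr2 mulrA [leRHS]mulrC.
by rewrite ler_wpM2l ?norm2_ge0 ?norm2_mulmx_le.
Qed.

End dot_product.

Section supported_vectors.
Variable p : nat.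
Implicit Types (u v : 'cV[R]_p) (J K : {set 'I_p}).

Lemma supportedP J u : supported J u <-> forall j, j \notin J -> u j 0 = 0.
Proof.
split=> [/fintype.subsetP uJ j jJ|uJ].
  by apply/eqP/negPn/negP => uj; case/negP: jJ; apply: uJ; rewrite inE.
apply/fintype.subsetP => j; rewrite inE => uj; apply/negPn/negP => jJ.
by rewrite uJ ?eqxx in uj.
Qed.

Lemma supportedS J K u : J \subset K -> supported J u -> supported K u.
Proof. by move=> JK uJ; exact: fintype.subset_trans JK. Qed.

Lemma supported0 J : supported J (0 : 'cV[R]_p).
Proof. by apply/supportedP => j _; rewrite mxE. Qed.

Lemma supportedD J u v : supported J u -> supported J v -> supported J (u + v).
Proof.
move=> /supportedP uJ /supportedP vJ; apply/supportedP => j jJ.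
by rewrite mxE uJ ?vJ ?addr0.
Qed.

Lemma supportedZ J a u : supported J u -> supported J (a *: u).
Proof.
by move=> /supportedP uJ; apply/supportedP => j jJ; rewrite mxE uJ ?mulr0.
Qed.

Lemma supportedN J u : supported J u -> supported J (- u).
Proof. by rewrite -scaleN1r; exact: supportedZ. Qed.

Lemma supportedB J u v : supported J u -> supported J v -> supported J (u - v).
Proof. by move=> uJ vJ; apply: supportedD => //; exact: supportedN. Qed.

Lemma supported_sum J (I : finType) (F : I -> 'cV[R]_p) :
  (forall i, supported J (F i)) -> supported J (\sum_i F i).
Proof.
move=> FJ; elim/big_ind : _ => //; first exact: supported0.
by move=> u v; exact: supportedD.
Qed.

Lemma supported_delta J j : j \in J -> supported J (delta_mx j 0 : 'cV[R]_p).
Proof.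
move=> jJ; apply/supportedP => i iJ; rewrite mxE.
by case: eqVneq => [ij|//]; rewrite ij jJ in iJ.
Qed.

(** Passage from zero-filled vectors to vectors of length [#|J|], on which [principal_submx J]
    acts. *)
Definition restrict J u : 'cV[R]_#|J| := \col_i u (enum_val i) 0.

Lemma dotp_restrict J u v : supported J u ->
  dotp (restrict J u) (restrict J v) = dotp u v.
Proof.
move=> /supportedP uJ; rewrite /dotp [RHS](bigID (mem J)) /=.
rewrite [X in _ = _ + X]big1 ?addr0 => [|j jJ]; last by rewrite uJ ?mul0r.
by rewrite [RHS]big_enum_val; apply: eq_bigr => i _; rewrite !mxE.
Qed.

Lemma norm2_restrict J u : supported J u -> norm2 (restrict J u) = norm2 u.
Proof. by move=> uJ; rewrite /norm2 dotp_restrict. Qed.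

Lemma principal_submx_restrict J (A : 'M[R]_p) u : supported J u ->
  principal_submx J A *m restrict J u = restrict J (A *m u).
Proof.
move=> /supportedP uJ; apply/matrixP => i k; rewrite !mxE.
rewrite [RHS](bigID (mem J)) /= [X in _ = _ + X]big1 ?addr0 => [|j jJ].
  by rewrite [RHS]big_enum_val; apply: eq_bigr => j _; rewrite !mxE.
by rewrite uJ ?mulr0.
Qed.

(** Cauchy-Schwarz on the coordinates in [J] only: a coordinatewise bound costs a factor sqrt [#|J|]
    instead of sqrt [p]. *)
Lemma dotp_supported_le J u v (B : R) : supported J u ->
  (forall j, j \in J -> `|v j 0| <= B) ->
  `|dotp u v| <= norm2 u * Num.sqrt (#|J|%:R * B ^+ 2).
Proof.
move=> uJ vB; rewrite -(dotp_restrict v uJ) (le_trans (abs_dotp_le _ _)) //.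
rewrite norm2_restrict // ler_wpM2l ?norm2_ge0 // ler_wsqrtr //.
rewrite mulr_natl -[X in _ *+ X]card_ord -sumr_const; apply: ler_sum => i _.
have := vB _ (enum_valP i); rewrite mxE => vi; have := normr_ge0 (v (enum_val i) 0).
rewrite -expr2 -(real_normK (num_real _)) => v0.
by rewrite ler_pXn2r ?nnegrE // (le_trans v0).
Qed.

End supported_vectors.
End euclidean.

(** * Second-order expansion of the log-likelihood *)

Section cumulant_calculus.
Context {R : realType}.
Implicit Types s t x : R.

Lemma is_derive_continuous (f f' : R -> R) :
  (forall t, is_derive t 1 f (f' t)) -> continuous f.
Proof.
move=> df t; apply/differentiable_continuous/derivable1_diffP.
by case: (df t).
Qed.

(** The mean value theorem is applied to [f] minus its quadratic majorant, then to [f'] on [0, c]: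
    the derivative of the difference at [c] is [c * (f'' d - K)], hence nonpositive. *)
Lemma taylor2_le (f f' f'' : R -> R) K :
  (forall t, is_derive t 1 f (f' t)) -> (forall t, is_derive t 1 f' (f'' t)) ->
  (forall t, 0 <= t <= 1 -> f'' t <= K) -> f 1 - f 0 - f' 0 <= K / 2.
Proof.
move=> df df' f''K.
pose g t := f t - f' 0 * t - K / 2 * t ^+ 2.
have dg t : is_derive t 1 g (f' t - f' 0 - K * t).
  have dft := df t.
  apply: is_derive_eq.
  by rewrite /GRing.scale /=; field.
have [c /[!in_itv]/= /andP[c0 c1]] := @MVT R g _ 0 1 ltr01
  (fun x _ => dg x) (continuous_subspaceT (is_derive_continuous dg)).
have [d /[!in_itv]/= /andP[d0 d1] fc] := @MVT R f' f'' 0 c c0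
  (fun x _ => df' x) (continuous_subspaceT (is_derive_continuous df')).
rewrite {1 2}/g fc => E.
have : f'' d <= K by apply: f''K; rewrite (ltW d0) (le_trans (ltW d1)) ?ltW.
rewrite -(ler_pM2r c0); lra.
Qed.

(** The logistic function, which turns log-odds into probabilities. *)
Definition cumulant1 t : R := expR t / (1 + expR t).

Lemma expRD1_gt0 t : 0 < 1 + expR t.
Proof. by rewrite addr_gt0 ?expR_gt0. Qed.

Lemma is_derive_cumulant t : is_derive t 1 (@cumulant R) (cumulant1 t).
Proof.
have e0 := expRD1_gt0 t.
have dl : is_derive (1 + expR t) 1 (@ln R) (1 + expR t)^-1.
  exact: is_derive1_ln.
rewrite /cumulant1 mulrC.
apply: (@is_derive1_comp R (@ln R) (fun t => 1 + expR t)).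
by apply: is_derive_eq; rewrite add0r mul1r.
Qed.

Lemma is_derive_cumulant1 t : is_derive t 1 cumulant1 (cumulant2 t).
Proof.
have e0 := lt0r_neq0 (expRD1_gt0 t).
apply: is_derive_eq; rewrite /cumulant2 /GRing.scale /= ?expr2.
by field.
Qed.

Lemma cumulant2_ge0 t : 0 <= cumulant2 t.
Proof. by rewrite divr_ge0 ?expR_ge0 ?sqr_ge0. Qed.

(** [taylor2_le] for minus the cumulant along a segment, with bound 0 because [cumulant2] is
    nonnegative. *)
Lemma cumulant_tangent x t : cumulant x + cumulant1 x * t <= cumulant (x + t).
Proof.
have := @taylor2_le (fun s => - cumulant (x + s * t))
  (fun s => - (t * cumulant1 (x + s * t)))
  (fun s => - (t ^+ 2 * cumulant2 (x + s * t))) 0.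
rewrite !mul1r !mul0r !addr0; set P := (X in (X -> _) -> _) => H.
suff : - cumulant (x + t) - - cumulant x - - (t * cumulant1 x) <= 0 by lra.
have dx s : is_derive s 1 (fun s => x + s * t) t.
  by apply: is_derive_eq; rewrite /GRing.scale /=; ring.
apply: H => [s|s|s _]; last by rewrite oppr_le0 mulr_ge0 ?sqr_ge0 ?cumulant2_ge0.
  apply: is_deriveN; rewrite mulrC.
  exact: (is_derive1_comp (is_derive_cumulant _) (dx s)).
apply: is_deriveN; have d := is_derive1_comp (is_derive_cumulant1 _) (dx s).
by apply: is_derive_eq; rewrite /GRing.scale /=; ring.
Qed.

(** The tangent at x + s t is evaluated at both endpoints; with weights s and 1 - s the linear terms
    cancel. *)
Lemma cumulant_convex x t s : 0 <= s <= 1 ->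
  cumulant (x + s * t) <= (1 - s) * cumulant x + s * cumulant (x + t).
Proof.
move=> /andP[s0 s1].
have := cumulant_tangent (x + s * t) (- (s * t)).
have := cumulant_tangent (x + s * t) ((1 - s) * t).
have -> : x + s * t + (1 - s) * t = x + t by ring.
rewrite addrK => /(ler_wpM2l s0) h1 /(@ler_wpM2l _ (1 - s)) h2.
have s1' : 0 <= 1 - s by rewrite subr_ge0.
by have := lerD h1 (h2 s1'); lra.
Qed.

Lemma cumulant2_sqr_le t : cumulant2 t * t ^+ 2 <= 4.
Proof.
have e1 := expRD1_gt0 t; rewrite /cumulant2 mulrAC ler_pdivrMr ?exprn_gt0 //.
have -> : expR t = expR (t / 2) ^+ 2 by rewrite -expRM_natl; congr expR; field.
(* After halving, the claim is |a| e^a <= 1 + e^(2a). It follows from 1 + a <= e^a if a >= 0, and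
   from 1 - a <= e^(-a) if a < 0. *)
set a := t / 2; have -> : t = 2 * a by rewrite /a; field. clearbody a.
have ea := expR_gt0 a; have := expR_ge1Dx a; have := expR_ge1Dx (- a).
rewrite expRN => /(ler_wpM2r (ltW ea)); rewrite mulVf ?gt_eqF // => h1 h2.
have h3 := ler_wpM2l (ltW ea) h2.
have h : (expR a * a) ^+ 2 <= (1 + expR a ^+ 2) ^+ 2.
  have [a0|a0] := leP 0 a.
    rewrite ler_pXn2r ?nnegrE ?mulr_ge0 ?addr_ge0 ?sqr_ge0 ?expR_ge0 //; nra.
  rewrite -[leLHS]sqrrN ler_pXn2r ?nnegrE ?addr_ge0 ?sqr_ge0 //; nra.
by move: h; nra.
Qed.

End cumulant_calculus.

Section likelihood_expansion.
Context {R : realType}.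
Variables (n p : nat) (X : 'I_n -> 'cV[R]_p).
Implicit Types (b u v : 'cV[R]_p) (y : 'I_n -> bool).

Definition score b y : 'cV[R]_p :=
  \sum_i ((y i)%:R - cumulant1 (dotp (X i) b)) *: X i.

(* The Bregman divergence of the cumulant, which does not depend on the
   responses. *)
Definition bregman b u : R :=
  \sum_i (cumulant (dotp (X i) (b + u)) - cumulant (dotp (X i) b)
          - cumulant1 (dotp (X i) b) * dotp (X i) u).

Definition hess b u v : R := dotp u (neg_hessian X b *m v).

Lemma loglik_expand b u y :
  loglik X y (b + u) = loglik X y b + dotp u (score b y) - bregman b u.
Proof.
rewrite /loglik /score /bregman dotp_sumr -big_split -sumrB /=.
apply: eq_bigr => i _; rewrite dotpZr dotpDr (dotpC u); ring.
Qed.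

Lemma hessE b u v :
  hess b u v = \sum_i cumulant2 (dotp (X i) b) * (dotp (X i) u * dotp (X i) v).
Proof.
rewrite /hess /neg_hessian mulmx_suml dotp_sumr; apply: eq_bigr => i _.
rewrite -scalemxAl dotpZr; congr (_ * _).
rewrite -mulmxA [(X i)^T *m v]mx11_scalar -dotpE mul_mx_scalar dotpZr.
by rewrite (dotpC u) mulrC.
Qed.

Lemma hessC b u v : hess b u v = hess b v u.
Proof. by rewrite !hessE; apply: eq_bigr => i _; rewrite (mulrC (dotp _ u)). Qed.

Lemma hessDl b u v w : hess b (u + v) w = hess b u w + hess b v w.
Proof. exact: dotpDl. Qed.

Lemma hessZl b a u v : hess b (a *: u) v = a * hess b u v.
Proof. exact: dotpZl. Qed.

Lemma hess_suml b (I : finType) (F : I -> 'cV[R]_p) v :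
  hess b (\sum_i F i) v = \sum_i hess b (F i) v.
Proof. exact: dotp_suml. Qed.

Lemma hessZr b a u v : hess b v (a *: u) = a * hess b v u.
Proof. by rewrite hessC hessZl hessC. Qed.

Lemma hessDr b u v w : hess b w (u + v) = hess b w u + hess b w v.
Proof. by rewrite hessC hessDl !(hessC _ w). Qed.

Lemma hess_sumr b (I : finType) (F : I -> 'cV[R]_p) v :
  hess b v (\sum_i F i) = \sum_i hess b v (F i).
Proof. by rewrite hessC hess_suml; apply: eq_bigr => i _; exact: hessC. Qed.

Lemma hess_self_le b : hess b b b <= 4 * n%:R.
Proof.
rewrite hessE mulr_natr -[X in _ *+ X]card_ord -sumr_const.
by apply: ler_sum => i _; rewrite -expr2 cumulant2_sqr_le.
Qed.

(** [bregman b u] is the remainder on [0, 1] of the first-order Taylor expansion of [ray b u], whose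
    second derivative at [t] is the Hessian form at [b + t *: u]. *)
Let ray b u t : R := \sum_i cumulant (dotp (X i) b + t * dotp (X i) u).

Let ray1 b u t : R :=
  \sum_i dotp (X i) u * cumulant1 (dotp (X i) b + t * dotp (X i) u).

Let is_derive_ray b u (t : R) : is_derive t 1 (ray b u) (ray1 b u t).
Proof.
have dx i : is_derive t 1 (fun t : R => dotp (X i) b + t * dotp (X i) u)
    (dotp (X i) u).
  by apply: is_derive_eq; rewrite /GRing.scale /=; ring.
have -> : ray b u = \sum_i (fun t => cumulant (dotp (X i) b + t * dotp (X i) u)).
  by apply/funext => s; rewrite fct_sumE.
apply: is_derive_sum => i; rewrite mulrC.
exact: (is_derive1_comp (is_derive_cumulant _) (dx i)).
Qed.

Let is_derive_ray1 b u (t : R) : is_derive t 1 (ray1 b u) (hess (b + t *: u) u u).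
Proof.
have dx i : is_derive t 1 (fun t : R => dotp (X i) b + t * dotp (X i) u)
    (dotp (X i) u).
  by apply: is_derive_eq; rewrite /GRing.scale /=; ring.
have -> : ray1 b u = \sum_i (fun t =>
    dotp (X i) u * cumulant1 (dotp (X i) b + t * dotp (X i) u)).
  by apply/funext => s; rewrite fct_sumE.
rewrite hessE; apply: is_derive_sum => i.
have d := is_derive1_comp (is_derive_cumulant1 _) (dx i).
apply: is_derive_eq; rewrite dotpDr dotpZr /GRing.scale /=; ring.
Qed.

Let bregman_ray b u : bregman b u = ray b u 1 - ray b u 0 - ray1 b u 0.
Proof.
rewrite /bregman /ray /ray1 -!sumrB; apply: eq_bigr => i _.
by rewrite dotpDr mul1r mul0r addr0 [in RHS](mulrC (dotp _ _)).
Qed.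

Lemma bregman_le b u K : (forall t, 0 <= t <= 1 -> hess (b + t *: u) u u <= K) ->
  bregman b u <= K / 2.
Proof.
move=> HK; rewrite bregman_ray.
exact: taylor2_le (is_derive_ray b u) (is_derive_ray1 b u) HK.
Qed.

Lemma bregman_ge b u K : (forall t, 0 <= t <= 1 -> K <= hess (b + t *: u) u u) ->
  K / 2 <= bregman b u.
Proof.
move=> HK.
have := @taylor2_le R (fun t => - ray b u t) (fun t => - ray1 b u t)
  (fun t => - hess (b + t *: u) u u) (- K).
have H2 t : 0 <= t <= 1 -> - hess (b + t *: u) u u <= - K.
  by move=> /HK; rewrite lerN2.
move=> /(_ (fun t => is_deriveN (is_derive_ray b u t))).
move=> /(_ (fun t => is_deriveN (is_derive_ray1 b u t)) H2).
rewrite bregman_ray; lra.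
Qed.

(** The divergence is convex in [u], like the cumulant, and vanishes at 0. *)
Lemma bregmanZ_le b u s : 0 <= s <= 1 -> bregman b (s *: u) <= s * bregman b u.
Proof.
move=> s01; rewrite /bregman mulr_sumr; apply: ler_sum => i _.
rewrite !dotpDr dotpZr.
have := cumulant_convex (dotp (X i) b) (dotp (X i) u) s01; lra.
Qed.

End likelihood_expansion.

(** * Tail bounds for the score *)

Section likelihood_tails.
Context {R : realType}.
Variables (n p : nat) (X : 'I_n -> 'cV[R]_p) (b : 'cV[R]_p).
Implicit Types (u v : 'cV[R]_p) (y : {ffun 'I_n -> bool}).
Implicit Types (A B : pred {ffun 'I_n -> bool}).

(* expR (loglik X y b) is the probability of the responses y under b. *)
Definition prob (A : pred {ffun 'I_n -> bool}) : R :=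
  \sum_(y | A y) expR (loglik X y b).

(** The sum over all responses factorizes over the observations, each factor being (1 + e^t) / (1 +
    e^t). *)
Lemma sum_likelihood v : \sum_(y : {ffun 'I_n -> bool}) expR (loglik X y v) = 1.
Proof.
under eq_bigr => y _ do rewrite /loglik expR_sum.
pose F i (c : bool) := expR (c%:R * dotp (X i) v - cumulant (dotp (X i) v)).
rewrite -(bigA_distr_bigA F) big1 // => i _.
have e0 := expRD1_gt0 (dotp (X i) v).
rewrite big_bool /F /= mul1r mul0r !expRD expR0 expRN lnK ?posrE //.
by field; rewrite lt0r_neq0.
Qed.

Lemma probC A :
  prob A = 1 - prob [pred y | ~~ A y].
Proof.
by rewrite -(sum_likelihood b) [X in X - _](bigID A) /= addrK.
Qed.

Lemma prob_subset A B :
  (forall y, A y -> B y) -> prob A <= prob B.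
Proof.
move=> AB; rewrite /prob big_mkcond [leRHS]big_mkcond /=.
apply: ler_sum => y _; case: ifP => [/AB ->//|_].
by case: ifP => // _; exact: expR_ge0.
Qed.

(** Exponential tilting: on [A], the weight at [b] is at most exp(D(u) - x) times the weight at
    [b + u], and the latter weights have total mass 1. *)
Lemma prob_chernoff A u x :
  (forall y, A y -> x <= dotp u (score X b y)) ->
  prob A <= expR (bregman X b u - x).
Proof.
move=> Ax; rewrite -[leRHS]mulr1 -(sum_likelihood (b + u)) mulr_sumr.
rewrite /prob big_mkcond /=; apply: ler_sum => y _.
rewrite -expRD; case: ifP => [/Ax xS|_]; last exact: expR_ge0.
by rewrite ler_expR loglik_expand; lra.
Qed.

Lemma prob_union (I : finType) (P : pred I) A (B : I -> pred _) :
  (forall y, A y -> exists2 i, P i & B i y) ->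
  prob A <= \sum_(i | P i) prob (B i).
Proof.
move=> AB; rewrite /prob (exchange_big_dep predT) //= big_mkcond /=.
apply: ler_sum => y _; have S0 : 0 <= \sum_(i | P i && B i y) expR (loglik X y b).
  by apply: sumr_ge0 => i _; exact: expR_ge0.
case: ifP => [/AB[i Pi Bi]|_] //.
rewrite (bigD1 i) /=; last by rewrite Pi.
by rewrite lerDl; apply: sumr_ge0 => j _; exact: expR_ge0.
Qed.

(* The integers -(N-1), ..., N-1, with 0 occurring twice. *)
Definition signed_int N (c : bool * 'I_N) : R := (-1) ^+ c.1 * c.2%:R.

(** The first inequality puts the rounded vector m in the Chernoff event of level |m|^2 in its own
    direction, and keeps |m| below |x|; the second limits the loss to 1 per coordinate. *)
Lemma round_toward_zero N (x : R) : `|x| < N%:R -> exists c : bool * 'I_N,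
  signed_int c ^+ 2 <= x * signed_int c /\ (`|x| - 1) <= `|signed_int c|.
Proof.
move=> xN; have /andP[t1 t2] := truncn_itv (normr_ge0 x).
set t := Num.truncn `|x| in t1 t2.
have tN : (t < N)%N by rewrite -(ltr_nat R) (le_lt_trans t1).
exists (x < 0, Ordinal tN); rewrite /signed_int /=; split.
  have -> : x * ((-1) ^+ (x < 0)%R * t%:R) = `|x| * t%:R.
    by rewrite normrEsign mulrCA mulrA.
  by rewrite exprMn sqrr_sign mul1r expr2 ler_wpM2r.
rewrite normrM normr_sign mul1r ger0_norm //.
by rewrite lerBlDr (le_trans (ltW t2)) // -natr1.
Qed.

(** As j <= j^2, each of the two signs contributes at most a geometric series, uniformly in [N]. *)
Lemma sum_expR_sqr_le (a : R) N : 0 < a ->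
  \sum_(c : bool * 'I_N) expR (- (a * signed_int c ^+ 2)) <= 2 / (1 - expR (- a)).
Proof.
move=> a0; have x1 : expR (- a) < 1 by rewrite expR_lt1 oppr_lt0.
have -> : \sum_(c : bool * 'I_N) expR (- (a * signed_int c ^+ 2)) =
   \sum_(s : bool) \sum_(j < N) expR (- (a * signed_int (s, j) ^+ 2)).
  by rewrite pair_big; apply: eq_bigr => -[].
suff H (s : bool) : \sum_(j < N) expR (- (a * signed_int (s, j) ^+ 2))
    <= (1 - expR (- a))^-1.
  by rewrite big_bool; have := lerD (H true) (H false); rewrite mulr2n mulrDl !mul1r.
have -> : (1 - expR (- a))^-1 = (1 - expR (- a))^-1 * 1 by rewrite mulr1.
rewrite ler_pdivlMl ?subr_gt0 //.
apply: (@le_trans _ _ (1 - expR (- a) ^+ N)); last first.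
  by rewrite lerBlDr lerDl exprn_ge0 ?expR_ge0.
rewrite -[leRHS]opprB subrX1 -mulNr opprB ler_pM2l ?subr_gt0 //.
apply: ler_sum => j _; rewrite /signed_int exprMn sqrr_sign mul1r -expRM_natl.
rewrite ler_expR mulrN lerN2 mulrC ler_pM2l // -natrX ler_nat.
by case: (val j) => // i; rewrite expnS expn1 leq_pmull.
Qed.

Lemma lattice_gauss_sum (a : R) N k : 0 < a ->
  \sum_(m : {ffun 'I_k -> bool * 'I_N})
     expR (- (a * \sum_i signed_int (m i) ^+ 2)) <= (2 / (1 - expR (- a))) ^+ k.
Proof.
move=> a0.
under eq_bigr => m _ do rewrite mulr_sumr -sumrN expR_sum.
pose F (i : 'I_k) (c : bool * 'I_N) := expR (- (a * signed_int c ^+ 2)).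
rewrite -(bigA_distr_bigA F) /F prodr_const card_ord.
rewrite lerXn2r ?nnegrE ?sum_expR_sqr_le //.
  by apply: sumr_ge0 => c _; exact: expR_ge0.
by rewrite divr_ge0 // subr_ge0 ltW // expR_lt1 oppr_lt0.
Qed.

(* The vector z of coordinates <g_i, score> is rounded towards zero to an
   integer vector m: then m . z >= |m|^2 and |z| <= |m| + sqrt k, so a union
   bound over the lattice Z^k, with Chernoff's bound in the direction
   sum_i m_i g_i, yields Gaussian tails up to a factor C^k. *)
Lemma chi_square_tail k (g : 'I_k -> 'cV[R]_p) A (B T eta kap : R) :
  0 < kap -> eta + kap <= 1 ->
  (forall c : 'I_k -> R, \sum_i c i ^+ 2 <= B ->
     bregman X b (\sum_i c i *: g i) <= (1 + eta) / 2 * \sum_i c i ^+ 2) ->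
  (forall y, A y -> T <= \sum_i dotp (g i) (score X b y) ^+ 2 <= B) ->
  prob A <= (2 / (1 - expR (- (kap / 2)))) ^+ k *
    expR (- ((1 - eta - kap) / 2 * ((T - (1 + kap^-1) * k%:R) / (1 + kap)))).
Proof.
move=> kap0 ek gB AT.
(* Each |z_i| is at most 1 + B, so this range contains all rounded coordinates. *)
pose N := (Num.truncn (1 + B)).+1.
pose V := {ffun 'I_k -> bool * 'I_N}.
pose T' := (T - (1 + kap^-1) * k%:R) / (1 + kap).
pose q (m : V) : R := \sum_i signed_int (m i) ^+ 2.
pose u (m : V) := \sum_i signed_int (m i) *: g i.
have := @prob_union V (fun m => (T' <= q m) && (q m <= B)) A
  (fun m => [pred y : {ffun 'I_n -> bool} | q m <= dotp (u m) (score X b y)]).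
move=> /(_ _)/le_trans; apply.
  move=> y /AT /andP[Tz zB].
  pose z i := dotp (g i) (score X b y).
  have zN i : `|z i| < N%:R.
    have : z i ^+ 2 <= B.
      apply: le_trans zB; rewrite (bigD1 i) //= lerDl.
      by apply: sumr_ge0 => j _; exact: sqr_ge0.
    rewrite -[_ ^+ 2]real_normK ?num_real // => zB1.
    have B0 : 0 <= 1 + B by have := sqr_ge0 `|z i|; lra.
    have /andP[_ BN] := truncn_itv B0; apply: le_lt_trans BN.
    by have := sqr_ge0 (`|z i| - 1); nra.
  have [f /all_and2[f1 f2]] := fin_all_exists (fun i => round_toward_zero (zN i)).
  have qE : q (finfun f) = \sum_i signed_int (f i) ^+ 2.
    by apply: eq_bigr => i _; rewrite ffunE.
  (* Young's inequality for (s + 1)^2 with weight [kap]. Summed over i, it turns |z|^2 >= T into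
     |m|^2 >= T'. *)
  have f3 i : z i ^+ 2 <= (1 + kap) * signed_int (f i) ^+ 2 + (1 + kap^-1).
    have := f2 i; rewrite -(real_normK (num_real (z i))).
    rewrite -(real_normK (num_real (signed_int (f i)))).
    move: `|z i| `|_ (f i)| (normr_ge0 (z i)) (normr_ge0 (signed_int (f i))).
    move=> a s a0 s0 as1; have : a ^+ 2 <= (s + 1) ^+ 2 by nra.
    move=> /le_trans; apply.
    have -> : (1 + kap) * s ^+ 2 + (1 + kap^-1) =
      (s + 1) ^+ 2 + kap^-1 * (kap * s - 1) ^+ 2 by field; rewrite gt_eqF.
    by rewrite lerDl mulr_ge0 ?sqr_ge0 // invr_ge0 ltW.
  exists (finfun f); rewrite qE.
    apply/andP; split.
      rewrite ler_pdivrMr ?addr_gt0 // lerBlDr (le_trans Tz) //.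
      rewrite (le_trans (ler_sum _ (fun i _ => f3 i))) // big_split /=.
      by rewrite -mulr_sumr sumr_const card_ord mulr_natr mulrC.
    apply: le_trans zB; apply: ler_sum => i _.
    by have := f1 i; have := sqr_ge0 (z i - signed_int (f i)); rewrite -/(z i); nra.
  rewrite inE /u dotp_suml; apply: ler_sum => i _.
  by rewrite ffunE dotpZl mulrC f1.
(* The Chernoff exponent -(1 - eta) |m|^2 / 2 is split: a share kap / 2 makes the sum over the
   lattice converge, the rest is bounded using |m|^2 >= T'. *)
have := lattice_gauss_sum N k (divr_gt0 kap0 (ltr0n R 2)).
move=> /(ler_wpM2r (expR_ge0 (- ((1 - eta - kap) / 2 * T')))).
apply: le_trans; rewrite big_mkcond mulr_suml; apply: ler_sum => m _ /=.
rewrite -expRD; case: ifPn => [/andP[Tq qB]|_]; last exact: expR_ge0.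
apply: (le_trans (@prob_chernoff _ (u m) (q m) (fun y => id))).
rewrite ler_expR -/(q m).
have := gB (fun i => signed_int (m i)) qB.
rewrite -/(q m) -/(u m) => Dq.
have : (1 - eta - kap) / 2 * T' <= (1 - eta - kap) / 2 * q m.
  by rewrite ler_wpM2l //; lra.
lra.
Qed.

End likelihood_tails.

(** * The geometry of the Hessian *)

Section hessian_geometry.
Context {R : realType}.
Variables (n p : nat) (X : 'I_n -> 'cV[R]_p) (b : 'cV[R]_p).
Implicit Types (u v : 'cV[R]_p) (s : seq 'I_p) (J K : {set 'I_p}).
Let B := hess X b.

Definition hess_posdef J := forall u, supported J u -> u != 0 -> 0 < B u u.

Lemma hess_posdefS J K : J \subset K -> hess_posdef K -> hess_posdef J.
Proof. by move=> JK HK u uJ; apply: HK; exact: supportedS uJ. Qed.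

(** Supports follow the prefixes of [s], so that a single orthonormal basis spans all prefix
    subspaces at once. *)
Lemma gram_schmidt s : uniq s -> hess_posdef [set j in s] ->
  exists f : nat -> 'cV[R]_p,
  [/\ forall i, (i < size s)%N -> supported [set j in take i.+1 s] (f i),
      forall i j, (i < size s)%N -> (j < size s)%N -> B (f i) (f j) = (i == j)%:R &
      forall m u, (m <= size s)%N -> supported [set j in take m s] u ->
        u = \sum_(i < m) B (f i) u *: f i].
Proof.
elim/last_ind: s => [_ _|s j IHs].
  exists (fun=> 0); split=> // m u; rewrite leqn0 => /eqP -> /supportedP u0.
  by rewrite big_ord0; apply/matrixP => i k; rewrite ord1 mxE u0 // inE.
rewrite rcons_uniq => /andP[js us] pd.
have sub : [set x in s] \subset [set x in rcons s j].
  by apply/fintype.subsetP => x; rewrite !inE mem_rcons inE => ->; rewrite orbT.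
have [f [fs fo fu]] := IHs us (hess_posdefS sub pd).
have fS (i : 'I_(size s)) : supported [set x in s] (f i).
  apply: supportedS (fs i (ltn_ord i)); apply/fintype.subsetP => x.
  by rewrite !inE => /mem_take.
pose e : 'cV[R]_p := delta_mx j 0.
(* As [j] is not in [s], the coordinate [j] of [w] is 1; hence [w] is nonzero and can be
   normalized. *)
pose w := e - \sum_(i < size s) B (f i) e *: f i.
have sumS (c : 'I_(size s) -> R) : supported [set x in s] (\sum_i c i *: f i).
  by apply: supported_sum => i; exact: supportedZ.
have wS : supported [set x in rcons s j] w.
  apply: supportedB; last exact: supportedS (sumS _).
  by apply: supported_delta; rewrite inE mem_rcons inE eqxx.
have wj : w j 0 = 1.
  have /supportedP/(_ j) := sumS (fun i => B (f i) e); rewrite inE => /(_ js) E.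
  by rewrite mxE [X in _ + X]mxE E oppr0 addr0 mxE !eqxx.
have fw i : (i < size s)%N -> B (f i) w = 0.
  move=> si; rewrite /w /B -scaleN1r hessDr hessZr hess_sumr.
  rewrite (bigD1 (Ordinal si)) //= hessZr -/B fo // eqxx mulr1.
  rewrite big1 ?addr0 ?mulN1r ?subrr // => k ki; rewrite /B hessZr -/B fo //.
  have /negbTE : val k != i by [].
  by rewrite eq_sym => ->; rewrite mulr0.
have w0 : 0 < B w w.
  apply: pd => //; apply/eqP => w0; move: wj.
  by rewrite w0 mxE => /eqP; rewrite eq_sym oner_eq0.
clearbody w.
have [h h0 hh] : exists2 h, 0 < h & h * h = B w w.
  exists (Num.sqrt (B w w)); first by rewrite sqrtr_gt0.
  by rewrite -expr2 sqr_sqrtr // ltW.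
pose f' i := if (i < size s)%N then f i else h^-1 *: w.
have f'E i : (i < size s)%N -> f' i = f i by rewrite /f' => ->.
have f'n : f' (size s) = h^-1 *: w by rewrite /f' ltnn.
exists f'; rewrite size_rcons; split.
- move=> i; rewrite ltnS leq_eqVlt => /orP[/eqP ->|si].
    by rewrite f'n -(size_rcons s j) take_size; exact: supportedZ.
  by rewrite f'E // -cats1 takel_cat //; exact: fs.
- move=> i k; rewrite !ltnS [(i <= _)%N]leq_eqVlt [(k <= _)%N]leq_eqVlt.
  move=> /orP[/eqP ->|si] /orP[/eqP ->|sk].
  + by rewrite f'n /B hessZl hessZr -/B -hh eqxx mulKf ?mulVf ?gt_eqF.
  + by rewrite f'n f'E // /B hessZl hessC -/B fw // mulr0 gtn_eqF.
  + by rewrite f'n f'E // /B hessZr -/B fw // mulr0 ltn_eqF.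
  + by rewrite !f'E // fo.
- move=> m u; rewrite [(m <= _)%N]leq_eqVlt => /orP[/eqP ->|].
    rewrite -(size_rcons s j) take_size size_rcons => /supportedP uS.
    rewrite big_ord_recr /= f'n.
    (* Subtracting a multiple of [w] clears the coordinate [j], so the induction hypothesis expands
       the difference; its coefficients are those of [u], by orthogonality to [w]. *)
    have vS : supported [set x in take (size s) s] (u - u j 0 *: w).
      rewrite take_size; apply/supportedP => x; rewrite inE => xs.
      have [->|xj] := eqVneq x j; first by rewrite !mxE wj mulr1 subrr.
      have xS : x \notin [set x in rcons s j] by rewrite inE mem_rcons inE negb_or xj.
      have /supportedP/(_ x xS) wx := wS; have ux := uS x xS.
      by rewrite !mxE ux wx mulr0 subrr.
    have := fu _ _ (leqnn _) vS.
    have -> : \sum_(i < size s) B (f i) (u - u j 0 *: w) *: f i =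
              \sum_(i < size s) B (f' i) u *: f' i.
      apply: eq_bigr => i _; rewrite f'E // /B -scaleNr hessDr hessZr -/B fw //.
      by rewrite mulr0 addr0.
    move=> uE; have Bwu : B w u = u j 0 * B w w.
      rewrite -{1}(subrK (u j 0 *: w) u) /B hessDr hessZr -/B uE.
      rewrite {1}/B hess_sumr big1 ?add0r // => i _.
      by rewrite hessZr hessC f'E // -/B fw // mulr0.
    rewrite -uE /B hessZl -/B Bwu -hh scalerA.
    have -> : h^-1 * (u j 0 * (h * h)) / h = u j 0 by field; rewrite gt_eqF.
    by rewrite subrK.
  rewrite ltnS => ms; rewrite -cats1 takel_cat // => uS.
  rewrite [LHS](fu m u ms uS); apply: eq_bigr => i _.
  by rewrite f'E // (leq_trans (ltn_ord i)).
Qed.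

(** Gram-Schmidt with the coordinates of [J0] listed first: the initial vectors span R^J0, the
    remaining ones its H-orthogonal complement in R^J. *)
Lemma hess_complement_basis (J0 J : {set 'I_p}) : J0 \subset J -> hess_posdef J ->
  exists g : 'I_#|J :\: J0| -> 'cV[R]_p,
  [/\ forall i, supported J (g i),
      forall i j, B (g i) (g j) = (i == j)%:R,
      forall i a, supported J0 a -> B (g i) a = 0 &
      forall u, supported J u -> supported J0 (u - \sum_i B (g i) u *: g i)].
Proof.
move=> J0J pd; pose s := enum J0 ++ enum (J :\: J0).
have Js : [set j in s] = J.
  apply/setP => j; rewrite inE mem_cat !mem_enum inE.
  case: (boolP (j \in J0)) => //= jJ0; exact/esym/(fintype.subsetP J0J).
have us : uniq s.
  rewrite cat_uniq !enum_uniq /= andbT; apply/hasPn => j.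
  by rewrite !mem_enum inE => /andP[].
have szE : size s = (#|J0| + #|J :\: J0|)%N by rewrite size_cat !cardE.
have [|f [fs fo fu]] := gram_schmidt us; first by rewrite Js.
have szJ0 : (#|J0| <= size s)%N by rewrite szE leq_addr.
have takeJ0 : [set j in take #|J0| s] = J0.
  by apply/setP => j; rewrite inE cardE take_size_cat // mem_enum.
pose g (i : 'I_#|J :\: J0|) := f (#|J0| + i)%N.
have gs (i : 'I_#|J :\: J0|) : (#|J0| + i < size s)%N by rewrite szE ltn_add2l.
exists g; split.
- move=> i; apply: supportedS (fs _ (gs i)); rewrite -{2}Js.
  by apply/fintype.subsetP => j; rewrite !inE => /mem_take.
- by move=> i j; rewrite fo // eqn_add2l.
- move=> i a aJ0; rewrite (fu #|J0| a) ?takeJ0 // /B hess_sumr big1 // => k _.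
  rewrite hessZr -/B fo //; last by rewrite (leq_trans (ltn_ord k)).
  by rewrite gtn_eqF ?mulr0 // (leq_trans (ltn_ord k)) ?leq_addr.
- move=> u uJ; have uE := fu (size s) u (leqnn _).
  rewrite take_size Js in uE; move: (uE uJ); rewrite szE big_split_ord /= => {}uE.
  rewrite {1}uE addrK; apply: supported_sum => i; apply: supportedZ.
  have i0 : (i < size s)%N := leq_trans (ltn_ord i) szJ0.
  apply: supportedS (fs i i0); rewrite -{2}takeJ0.
  apply/fintype.subsetP => j; rewrite !inE -(take_takel s (ltn_ord i)).
  exact: mem_take.
Qed.

End hessian_geometry.

Section hessian_bounds.
Context {R : realType}.
Variables (n p : nat) (X : 'I_n -> 'cV[R]_p).
Implicit Types (b u v : 'cV[R]_p) (J : {set 'I_p}).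

(* The likelihood is quadratic up to a cubic error on the model J around b. *)
Definition quad_approx b J (cl cu c : R) := forall u, supported J u ->
  [/\ n%:R * cl * norm2 u ^+ 2 <= hess X b u u,
      hess X b u u <= n%:R * cu * norm2 u ^+ 2 &
      `|bregman X b u - hess X b u u / 2| <= n%:R * c * norm2 u ^+ 3 / 2].

Lemma hess_restrict b J u : supported J u ->
  dotp (restrict J u) (principal_submx J (neg_hessian X b) *m restrict J u)
  = hess X b u u.
Proof. by move=> uJ; rewrite principal_submx_restrict // dotp_restrict. Qed.

(** Since [J] contains the support of [b], the segment from [b] to [b + u] stays in R^J. Along it
    the Hessian form moves by at most n c |u|^3; bounding [t] by 1 gives the constant 1/2 instead of
    1/6. *)
Lemma quad_approx_of_conditions q (c_lower c_upper : R -> R) c a0 b J :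
  (0 < n)%N -> 0 <= c ->
  (forall s t, 0 <= s -> s <= t -> c_lower t <= c_lower s) ->
  (forall s t, 0 <= s -> s <= t -> c_upper s <= c_upper t) ->
  hessian_conditions X q (supp b) c_lower c_upper c ->
  norm2 b <= a0 -> supp b \subset J -> (#|J| <= 2 * q)%N ->
  quad_approx b J (c_lower a0) (c_upper a0) c.
Proof.
move=> n0 c0 ldec uinc HC ba bJ Jq u uJ.
have nR : 0 < n%:R :> R by rewrite ltr0n.
have sb : supported J b by [].
have [[_ HL] [_ HU] _] := HC J bJ Jq b b sb sb.
have nu0 := sqr_ge0 (norm2 u); have nb0 := norm2_ge0 b.
have L : c_lower a0 * norm2 u ^+ 2 <= n%:R^-1 * hess X b u u.
  have := HL (restrict J u).
  rewrite mulmxBl dotpBr -scalemxAl dotpZr hess_restrict // mul_scalar_mx dotpZr.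
  rewrite dotp_restrict // -sqr_norm2 subr_ge0; apply: le_trans.
  by rewrite ler_wpM2r // ldec.
have U : n%:R^-1 * hess X b u u <= c_upper a0 * norm2 u ^+ 2.
  have := HU (restrict J u).
  rewrite mulmxBl dotpBr -scalemxAl dotpZr hess_restrict // mul_scalar_mx dotpZr.
  rewrite dotp_restrict // -sqr_norm2 subr_ge0 => /le_trans; apply.
  by rewrite ler_wpM2r // uinc.
split; [by rewrite -mulrA -ler_pdivlMl|by rewrite -mulrA -ler_pdivrMl|].
have W t : 0 <= t <= 1 ->
    `|hess X (b + t *: u) u u - hess X b u u| <= n%:R * c * norm2 u ^+ 3.
  move=> /andP[t0 t1].
  have [_ _] := HC J bJ Jq (b + t *: u) b (supportedD sb (supportedZ t uJ)) sb.
  rewrite addrAC subrr add0r norm2Z ger0_norm // ler_pdivrMl // => S.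
  rewrite -!(hess_restrict _ uJ) -dotpBr -mulmxBl.
  rewrite (le_trans (quad_spectral_le _ _)) // norm2_restrict //.
  rewrite [_ ^+ 3]exprS [leRHS]mulrA ler_wpM2r // (le_trans S) // -mulrA.
  rewrite ler_wpM2l ?ler0n // ler_wpM2l //.
  by rewrite ler_piMl ?norm2_ge0.
rewrite ler_norml; apply/andP; split.
  rewrite lerBrDr -mulNr -mulrDl; apply: bregman_ge => t /W.
  by rewrite ler_norml => /andP[+ _]; lra.
rewrite lerBlDr -mulrDl; apply: bregman_le => t /W.
by rewrite ler_norml => /andP[_ +]; lra.
Qed.

End hessian_bounds.

(** * Likelihood comparisons for a bounded score *)

Section likelihood_comparison.
Context {R : realType}.
Variables (n p : nat) (X : 'I_n -> 'cV[R]_p) (b : 'cV[R]_p).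
Variables (cl cu c : R).
Hypotheses (n_gt0 : (0 < n)%N) (cl_gt0 : 0 < cl) (cu_gt0 : 0 < cu) (c_gt0 : 0 < c).
Implicit Types (u v : 'cV[R]_p) (J : {set 'I_p}) (L r : R).

Let nR : 0 < n%:R :> R. Proof. by rewrite ltr0n. Qed.

Definition score_bound (y : 'I_n -> bool) J L :=
  forall u, supported J u -> `|dotp u (score X b y)| <= L * norm2 u.

Lemma maxloglik_ge y J u : supported J u -> loglik X y u <= maxloglik X y J.
Proof.
move=> uJ; apply: ub_le_sup; last by exists u.
by case: (maxloglik_has_sup X y J).
Qed.

Lemma maxloglik_le y J (M : R) :
  (forall u, supported J u -> loglik X y u <= M) -> maxloglik X y J <= M.
Proof.
move=> uM; apply: ge_sup; first by case: (maxloglik_has_sup X y J).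
by move=> _ [u uJ <-]; exact: uM.
Qed.

Lemma quad_approx_posdef J : quad_approx X b J cl cu c -> hess_posdef X b J.
Proof.
move=> QA u uJ u0; have [Ql _ _] := QA u uJ; apply: lt_le_trans Ql.
have nu : 0 < norm2 u.
  rewrite lt_neqAle norm2_ge0 andbT eq_sym.
  by apply: contra_neq u0; exact: norm2_eq0.
by rewrite mulr_gt0 ?exprn_gt0 // mulr_gt0.
Qed.

(* Quadratic growth on the sphere of radius r propagates linearly along rays,
   by convexity. *)
Lemma bregman_growth J u r : quad_approx X b J cl cu c -> supported J u ->
  0 < r -> r <= norm2 u -> c * r <= cl / 2 ->
  n%:R * cl * r / 4 * norm2 u <= bregman X b u.
Proof.
move=> QA uJ r0 ru cr; have u0 : 0 < norm2 u := lt_le_trans r0 ru.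
pose s := r / norm2 u.
have s0 : 0 < s by rewrite divr_gt0.
have s01 : 0 <= s <= 1 by rewrite ltW //= ler_pdivrMr // mul1r.
have su : norm2 (s *: u) = r by rewrite norm2Z gtr0_norm // divfK // gt_eqF.
have [] := QA _ (supportedZ s uJ); rewrite su ler_norml => Ql _ /andP[Qd _].
have := bregmanZ_le X b u s01.
have -> : n%:R * cl * r / 4 * norm2 u = n%:R * cl * r ^+ 2 / 4 / s.
  by rewrite /s; field; rewrite !gt_eqF.
rewrite ler_pdivrMr // [_ * s]mulrC; apply: le_trans.
have : n%:R * r ^+ 2 * (c * r) <= n%:R * r ^+ 2 * (cl / 2).
  by rewrite ler_wpM2l // mulr_ge0 ?sqr_ge0 ?ltW.
rewrite exprS in Qd; lra.
Qed.

Section complement_basis.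
Variables (J : {set 'I_p}) (k : nat) (g : 'I_k -> 'cV[R]_p).
Hypothesis QA : quad_approx X b J cl cu c.
Hypothesis gJ : forall i, supported J (g i).
Hypothesis gB : forall i j, hess X b (g i) (g j) = (i == j)%:R.

Lemma hess_orthonormal_sum (d : 'I_k -> R) :
  hess X b (\sum_i d i *: g i) (\sum_i d i *: g i) = \sum_i d i ^+ 2.
Proof.
rewrite hess_suml; apply: eq_bigr => i _; rewrite hessZl hess_sumr.
rewrite (bigD1 i) //= hessZr gB eqxx mulr1 big1 ?addr0 // => j ji.
by rewrite hessZr gB eq_sym (negbTE ji) mulr0.
Qed.

Lemma sqr_norm2_orthonormal_sum (d : 'I_k -> R) :
  n%:R * cl * norm2 (\sum_i d i *: g i) ^+ 2 <= \sum_i d i ^+ 2.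
Proof.
rewrite -hess_orthonormal_sum.
by case: (QA (supported_sum (fun i => supportedZ (d i) (gJ i)))).
Qed.

(** Let v be the sum of the z_i g_i. The score bound at v gives |z|^2 <= L |v|, while n cl |v|^2 <=
    |z|^2. The result is the a priori radius [B] of [chi_square_tail]. *)
Lemma sum_sqr_score_le y L : score_bound y J L ->
  \sum_i dotp (g i) (score X b y) ^+ 2 <= L ^+ 2 / (n%:R * cl).
Proof.
move=> SL; pose z i := dotp (g i) (score X b y).
rewrite -/(\sum_i z i ^+ 2); set Z := \sum_i _.
have := sqr_norm2_orthonormal_sum z; rewrite -/Z => vZ.
have Z0 : 0 <= Z by apply: sumr_ge0 => i _; exact: sqr_ge0.
have := SL _ (supported_sum (fun i => supportedZ (z i) (gJ i))).
have -> : dotp (\sum_i z i *: g i) (score X b y) = Z.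
  by rewrite dotp_suml; apply: eq_bigr => i _; rewrite dotpZl.
rewrite ger0_norm //; set v := norm2 _ in vZ * => Zv.
have nc : 0 < n%:R * cl by rewrite mulr_gt0.
rewrite ler_pdivlMr //.
have [Z_eq0|Zn0] := eqVneq Z 0; first by rewrite Z_eq0 mul0r sqr_ge0.
have Zp : 0 < Z by rewrite lt_neqAle eq_sym Zn0.
rewrite -(ler_pM2l Zp) [leRHS]mulrC.
apply: (@le_trans _ _ (n%:R * cl * (L * v) ^+ 2)).
  have : Z ^+ 2 <= (L * v) ^+ 2 by rewrite ler_pXn2r ?nnegrE // (le_trans Z0).
  by move=> /(ler_wpM2l (ltW nc)); rewrite expr2; lra.
rewrite exprMn mulrCA ler_wpM2l ?sqr_ge0 //.
Qed.

(** In this range the vector has norm at most L / (n cl), so one factor of the cubic error is small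
    and the other two are absorbed by the quadratic form. *)
Lemma bregman_orthonormal_sum (d : 'I_k -> R) L : 0 <= L ->
  \sum_i d i ^+ 2 <= L ^+ 2 / (n%:R * cl) ->
  bregman X b (\sum_i d i *: g i) <=
    (1 + c * L / (n%:R * cl ^+ 2)) / 2 * \sum_i d i ^+ 2.
Proof.
move=> L0 dL; have vD := sqr_norm2_orthonormal_sum d.
have [_ _] := QA (supported_sum (fun i => supportedZ (d i) (gJ i))).
rewrite hess_orthonormal_sum ler_norml => /andP[_].
set v := norm2 _ in vD *; set Q := \sum_i _ in dL vD *.
have v0 : 0 <= v by exact: norm2_ge0.
have nc : 0 < n%:R * cl by rewrite mulr_gt0.
have vL : v <= L / (n%:R * cl).
  rewrite -(@ler_pXn2r _ 2) ?nnegrE ?divr_ge0 ?(ltW nc) //.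
  rewrite -(ler_pM2l nc) (le_trans vD) // (le_trans dL) // expr_div_n.
  by rewrite le_eqVlt; apply/orP; left; apply/eqP; field; rewrite !gt_eqF.
rewrite lerBlDr => /le_trans; apply.
have -> : (1 + c * L / (n%:R * cl ^+ 2)) / 2 * Q =
   c / (cl * 2) * (L / (n%:R * cl)) * Q + Q / 2.
  by field; rewrite !gt_eqF.
rewrite lerD2r.
have -> : n%:R * c * v ^+ 3 / 2 = c / (cl * 2) * (v * (n%:R * cl * v ^+ 2)).
  by field; rewrite gt_eqF.
rewrite -[leRHS]mulrA; apply: ler_wpM2l.
  by rewrite divr_ge0 ?(ltW c_gt0) // mulr_ge0 ?(ltW cl_gt0).
by apply: ler_pM => //; rewrite mulr_ge0 ?sqr_ge0 ?(ltW nc).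
Qed.

End complement_basis.

(** Beyond radius [r] the divergence beats the score, and [b] itself does at least as well. Within
    it, [b + a] competes in the model [J0]; [r'] bounds |a| because the Hessian form of [a] is at
    most that of [u]. The two radii account for the cubic errors at [u] and at [a]. *)
Lemma superset_gain_le y (J0 J : {set 'I_p}) L r r' k (g : 'I_k -> 'cV[R]_p) :
  J0 \subset J -> supp b \subset J0 -> quad_approx X b J cl cu c ->
  (forall i, supported J (g i)) ->
  (forall i j, hess X b (g i) (g j) = (i == j)%:R) ->
  (forall i a, supported J0 a -> hess X b (g i) a = 0) ->
  (forall u, supported J u ->
     supported J0 (u - \sum_i hess X b (g i) u *: g i)) ->
  score_bound y J L -> 0 < r -> 4 * L <= n%:R * cl * r -> c * r <= cl / 2 ->
  0 <= r' -> cu * r ^+ 2 <= cl * r' ^+ 2 ->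
  maxloglik X y J - maxloglik X y J0 <=
    (\sum_i dotp (g i) (score X b y) ^+ 2) / 2 + n%:R * c * (r ^+ 3 + r' ^+ 3) / 2.
Proof.
move=> J0J bJ0 QA gJ gB gJ0 gdec SL r0 Lr cr r'0 rr'.
pose z i := dotp (g i) (score X b y).
rewrite -/(\sum_i z i ^+ 2) lerBlDr; apply: maxloglik_le => beta betaJ.
have bJ : supported J b := supportedS J0J bJ0.
pose u := beta - b; have uJ : supported J u := supportedB betaJ bJ.
have -> : beta = b + u by rewrite addrC subrK.
have Z0 : 0 <= \sum_i z i ^+ 2 by apply: sumr_ge0 => i _; exact: sqr_ge0.
have E0 : 0 <= n%:R * c * (r ^+ 3 + r' ^+ 3) / 2.
  rewrite divr_ge0 // mulr_ge0 ?addr_ge0 ?mulr_ge0 ?exprn_ge0 // ?(ltW r0) //.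
  exact: ltW.
have := SL _ uJ; rewrite loglik_expand => Su.
have [ur|ru] := leP (norm2 u) r; last first.
  have bJ0' : supported J0 b by [].
  have := bregman_growth QA uJ r0 (ltW ru) cr.
  have := maxloglik_ge y bJ0'; have := ler_norm (dotp u (score X b y)).
  have := ler_wpM2r (norm2_ge0 u) Lr; lra.
pose d i := hess X b (g i) u.
pose v := \sum_i d i *: g i.
pose a := u - v; have aJ0 : supported J0 a := gdec u uJ.
have aJ : supported J a := supportedS J0J aJ0.
have uav : u = a + v by rewrite subrK.
have va : hess X b v a = 0.
  by rewrite hess_suml big1 // => i _; rewrite hessZl gJ0 ?mulr0.
have Qu : hess X b u u = hess X b a a + \sum_i d i ^+ 2.
  rewrite {1 2}uav hessDl (hessDr X b a v a) (hessDr X b a v v).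
  rewrite va (hessC X b a v) va addr0 add0r.
  by rewrite hess_orthonormal_sum.
have D0 : 0 <= \sum_i d i ^+ 2 by apply: sumr_ge0 => i _; exact: sqr_ge0.
have uS : dotp u (score X b y) = dotp a (score X b y) + \sum_i d i * z i.
  rewrite {1}uav dotpDl; congr (_ + _); rewrite dotp_suml.
  by apply: eq_bigr => i _; rewrite dotpZl.
have dz : \sum_i d i * z i <= (\sum_i d i ^+ 2 + \sum_i z i ^+ 2) / 2.
  rewrite -big_split mulr_suml; apply: ler_sum => i _ /=.
  by have := sqr_ge0 (d i - z i); lra.
have [_ Uu] := QA u uJ; rewrite ler_norml => /andP[Du _].
have [La _] := QA a aJ; rewrite ler_norml => /andP[_ Da].
have := maxloglik_ge y (supportedD (bJ0 : supported J0 b) aJ0).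
rewrite loglik_expand => Ma.
have u3 : norm2 u ^+ 3 <= r ^+ 3 by rewrite lerXn2r ?nnegrE ?norm2_ge0 // ltW.
have u2 : norm2 u ^+ 2 <= r ^+ 2 by rewrite lerXn2r ?nnegrE ?norm2_ge0 // ltW.
have a2 : norm2 a <= r'.
  rewrite -(@ler_pXn2r _ 2) ?nnegrE ?norm2_ge0 //.
  rewrite -(ler_pM2l cl_gt0) (le_trans _ rr') // -(ler_pM2l nR).
  rewrite mulrA (le_trans La) //.
  apply: (@le_trans _ _ (hess X b u u)); first by rewrite Qu lerDl.
  by rewrite (le_trans Uu) // -mulrA ler_wpM2l ?(ltW nR) // ler_wpM2l // ltW.
have a3 : norm2 a ^+ 3 <= r' ^+ 3 by rewrite lerXn2r ?nnegrE ?norm2_ge0.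
have nc : 0 <= n%:R * c by rewrite mulr_ge0 ?ltW.
have := ler_wpM2l nc u3; have := ler_wpM2l nc a3; lra.
Qed.

(** The score consumes at most half of the growth n cl r |u| / 4; what remains is at least n cl r^2
    / 8. *)
Lemma false_model_loss_ge y J u L r :
  quad_approx X b J cl cu c -> score_bound y J L -> supported J u ->
  0 < r -> r <= norm2 u -> c * r <= cl / 2 -> 8 * L <= n%:R * cl * r ->
  loglik X y (b + u) <= loglik X y b - n%:R * cl * r ^+ 2 / 8.
Proof.
move=> QA SL uJ r0 ru cr Lr; rewrite loglik_expand.
have := bregman_growth QA uJ r0 ru cr; have := SL _ uJ.
have := ler_norm (dotp u (score X b y)).
have := ler_wpM2r (norm2_ge0 u) Lr.
have ncr : 0 <= n%:R * cl * r by rewrite !mulr_ge0 ?ltW.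
have := ler_wpM2l ncr ru; lra.
Qed.

(** Chernoff's bound in the directions tau e_j and -tau e_j, whence the factor 2. *)
Lemma prob_score_coord_gt j (tau B : R) : 0 < tau ->
  quad_approx X b (j |: supp b) cl cu c ->
  prob X b [pred y : {ffun 'I_n -> bool} | B < `|score X b y j 0|] <=
    2 * expR (n%:R * (cu * tau ^+ 2 + c * tau ^+ 3) / 2 - tau * B).
Proof.
move=> tau0 QA.
pose e (s : bool) : 'cV[R]_p := ((-1) ^+ s * tau) *: delta_mx j 0.
have eS s y : dotp (e s) (score X b y) = (-1) ^+ s * tau * score X b y j 0.
  rewrite dotpZl; congr (_ * _); rewrite /dotp (bigD1 j) //= mxE !eqxx mul1r.
  by rewrite big1 ?addr0 // => i ij; rewrite mxE (negbTE ij) mul0r.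
have eJ s : supported (j |: supp b) (e s).
  by apply/supportedZ/supported_delta; rewrite !inE eqxx.
have en s : norm2 (e s) = tau.
  rewrite norm2Z normrM normr_sign mul1r gtr0_norm // /norm2.
  suff -> : dotp (delta_mx j 0) (delta_mx j 0) = 1 :> R by rewrite sqrtr1 mulr1.
  rewrite /dotp (bigD1 j) //= mxE !eqxx mul1r.
  by rewrite big1 ?addr0 // => i ij; rewrite mxE (negbTE ij) mul0r.
have eP s : prob X b [pred y : {ffun 'I_n -> bool} |
    tau * B <= dotp (e s) (score X b y)] <=
    expR (n%:R * (cu * tau ^+ 2 + c * tau ^+ 3) / 2 - tau * B).
  apply: (le_trans (@prob_chernoff _ _ _ _ _ _ (e s) (tau * B) (fun y => id))).
  rewrite ler_expR; have [_] := QA _ (eJ s); rewrite en ler_norml.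
  by move=> Q /andP[_]; lra.
apply: (@le_trans _ _ (\sum_(s : bool) prob X b [pred y : {ffun 'I_n -> bool} |
    tau * B <= dotp (e s) (score X b y)])).
  apply: prob_union => y /= yB.
  exists (score X b y j 0 < 0) => //=.
  by rewrite eS mulrAC -normrEsign mulrC ler_wpM2r ?ltW.
by rewrite big_bool mulr_natl mulr2n; exact: lerD.
Qed.

End likelihood_comparison.

(** * The exceptional event *)

Section exceptional_event.
Context {R : realType}.

(** J is encoded by K = J \ J0, and K may range over all nonempty sets: the binomial theorem gives
    (1 + x / |I|)^|I| - 1 <= e^x - 1 <= 1 / 2. *)
Lemma sum_supersets_le (I : finType) (J0 : {set I}) (x : R) : 0 <= x <= 1 / 3 ->
  \sum_(J : {set I} | J0 \proper J) (x / #|I|%:R) ^+ #|J :\: J0| <= 1 / 2.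
Proof.
move=> /andP[x0 x1]; set a := x / #|I|%:R.
have a0 : 0 <= a by rewrite divr_ge0.
have -> : \sum_(J : {set I} | J0 \proper J) a ^+ #|J :\: J0| =
    \sum_(K in [set J :\: J0 | J : {set I} & J0 \proper J]) a ^+ #|K|.
  rewrite big_imset /= => [|J K]; first by apply: eq_bigl => J; rewrite inE.
  rewrite !inE => /andP[sJ _] /andP[sK _] JK.
  rewrite -(finset.setID J J0) -(finset.setID K J0) JK.
  by rewrite (finset.setIidPr sJ) (finset.setIidPr sK).
apply: (@le_trans _ _ (\sum_(K : {set I} | K != finset.set0) a ^+ #|K|)).
  rewrite big_mkcond [leRHS]big_mkcond /=; apply: ler_sum => K _.
  case: ifPn => [/imsetP[J]|_]; last by case: ifP => //; rewrite exprn_ge0.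
  rewrite inE => /properP[_ [j jJ jJ0]] KE; case: ifPn => //.
  by rewrite negbK KE => /eqP/finset.setP/(_ j); rewrite !inE jJ jJ0.
have S : \sum_(K : {set I}) a ^+ #|K| = (a + 1) ^+ #|I|.
  rewrite -prodr_const (@bigA_distr R 0 1 _ _ I (fun=> a) (fun=> 1)).
  apply: eq_bigr => K _; rewrite (bigID (mem K)) /=.
  rewrite [X in _ * X]big1 ?mulr1 => [|i /negbTE -> //].
  by rewrite -prodr_const; apply: eq_bigr => i ->.
rewrite (bigD1 finset.set0) //= cards0 expr0 in S.
have : (a + 1) ^+ #|I| <= expR x.
  have [I0|I0] := posnP #|I|; first by rewrite I0 expr0 -expR0 ler_expR.
  have -> : x = #|I|%:R * a by rewrite mulrC divfK // pnatr_eq0 -lt0n.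
  by rewrite expRM_natl lerXn2r ?nnegrE ?expR_ge0 ?addr_ge0 // addrC expR_ge1Dx.
rewrite -S => /le_trans/(_ _) le_e.
have ex : expR x <= 3 / 2.
  rewrite -[leRHS]invrK -[expR x]invrK lef_pV2 ?posrE ?invr_gt0 ?expR_gt0 //.
  rewrite -expRN; have := expR_ge1Dx (- x).
  have -> : (3 / 2)^-1 = 2 / 3 :> R by field.
  lra.
by have := le_e _ ex; lra.
Qed.

(** [rho] is sqrt(q lam / n), the order of the estimation error. The hypothesis says that G rho q <=
    1; as n rho^3 = q lam rho, this is where q^3 comes from. *)
Lemma sample_scale (n q : nat) (lam G : R) : (0 < n)%N -> (0 < q)%N ->
  0 < lam -> 0 < G -> G ^+ 2 * q%:R ^+ 3 * lam <= n%:R ->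
  exists rho, [/\ 0 < rho, G * rho <= 1, n%:R * rho ^+ 2 = q%:R * lam &
    G * (n%:R * rho ^+ 3) <= lam].
Proof.
move=> n0 q0 lam0 G0 nG; have nR : 0 < n%:R :> R by rewrite ltr0n.
have qR : 1 <= q%:R :> R by rewrite ler1n.
have qR0 : 0 < q%:R :> R by rewrite ltr0n.
pose rho := Num.sqrt (q%:R * lam / n%:R).
have rho0 : 0 < rho by rewrite sqrtr_gt0 divr_gt0 // mulr_gt0.
have rho2 : n%:R * rho ^+ 2 = q%:R * lam.
  by rewrite sqr_sqrtr ?(mulrC n%:R) ?divfK ?gt_eqF // ltW // divr_gt0 ?mulr_gt0.
have Grq : G * rho * q%:R <= 1.
  rewrite -(@ler_pXn2r _ 2) ?nnegrE ?mulr_ge0 ?(ltW G0) ?(ltW rho0) // expr1n.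
  rewrite -(ler_pM2l nR) mulr1 (le_trans _ nG) // !exprMn.
  have -> : n%:R * (G ^+ 2 * rho ^+ 2 * q%:R ^+ 2) =
    n%:R * rho ^+ 2 * (G ^+ 2 * q%:R ^+ 2) by ring.
  by rewrite rho2 le_eqVlt; apply/orP; left; apply/eqP; ring.
clearbody rho; exists rho; split => //.
  by rewrite (le_trans _ Grq) // ler_peMr // mulr_ge0 ?(ltW G0) ?(ltW rho0).
have -> : G * (n%:R * rho ^+ 3) = n%:R * rho ^+ 2 * (G * rho) by ring.
rewrite rho2 -[leRHS]mul1r mulrAC ler_wpM2r ?(ltW lam0) //.
by rewrite mulrC.
Qed.

Lemma min_signalE p (b : 'cV[R]_p) j0 : j0 \in supp b ->
  exists j, [/\ j \in supp b, min_signal b = (b j 0 ^+ 2)%:E &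
    forall i, i \in supp b -> b j 0 ^+ 2 <= b i 0 ^+ 2].
Proof.
move=> j0b; case: (Order.TotalTheory.arg_minP (fun j => b j 0 ^+ 2) j0b) => j jb jmin.
exists j; split => //; apply/eqP; rewrite eq_le; apply/andP; split.
  rewrite /min_signal (bigD1 j) //= real_normK ?num_real //.
  by rewrite ge_min lexx.
rewrite /min_signal; elim/big_ind: _ => [|x y xb yb|i ib].
- by rewrite leey.
- by rewrite le_min xb.
- by rewrite real_normK ?num_real // lee_fin jmin.
Qed.

Section superset_gain.
Variables (n p : nat) (X : 'I_n -> 'cV[R]_p) (b : 'cV[R]_p) (cl cu c : R).
Hypotheses (n_gt0 : (0 < n)%N) (cl_gt0 : 0 < cl) (cu_gt0 : 0 < cu) (c_gt0 : 0 < c).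

(** [chi_square_tail] with eta = kap; the score bound in the event supplies its upper bound on
    |z|^2. The part of the exponent linear in the number of added coordinates moves into the base of
    the power. *)
Lemma prob_superset_gain_gt (J : {set 'I_p}) (L r r' kap T M : R) :
  supp b \subset J -> quad_approx X b J cl cu c ->
  0 <= L -> 0 < r -> 4 * L <= n%:R * cl * r -> c * r <= cl / 2 ->
  0 <= r' -> cu * r ^+ 2 <= cl * r' ^+ 2 ->
  0 < kap -> 2 * kap <= 1 -> c * L / (n%:R * cl ^+ 2) <= kap ->
  T / 2 + n%:R * c * (r ^+ 3 + r' ^+ 3) / 2 <= M ->
  prob X b [pred y : {ffun 'I_n -> bool} | `[< score_bound X b y J L >] &&
      (M < maxloglik X y J - maxloglik X y (supp b))] <=
  (2 / (1 - expR (- (kap / 2))) * expR ((1 + kap^-1) / 2)) ^+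
      #|J :\: supp b| *
    expR (- ((1 - 2 * kap) / (1 + kap) * (T / 2))).
Proof.
move=> bJ QA L0 r0 Lr cr r'0 rr' kap0 kap1 cLk TM.
have [g [gJ gB gJ0 gdec]] :=
  hess_complement_basis bJ (quad_approx_posdef n_gt0 cl_gt0 QA).
have ek : kap + kap <= 1 by lra.
have gb (d : 'I_#|J :\: supp b| -> R) : \sum_i d i ^+ 2 <= L ^+ 2 / (n%:R * cl) ->
    bregman X b (\sum_i d i *: g i) <= (1 + kap) / 2 * \sum_i d i ^+ 2.
  move=> dB; apply: le_trans
    (bregman_orthonormal_sum n_gt0 cl_gt0 c_gt0 QA gJ gB L0 dB) _.
  apply: ler_wpM2r; first by apply: sumr_ge0 => i _; exact: sqr_ge0.
  by rewrite ler_pM2r // lerD2l.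
apply: le_trans (chi_square_tail (T := T) kap0 ek gb _) _.
  move=> y /= /andP[/asboolP SL gain]; apply/andP; split; last first.
    exact: (sum_sqr_score_le n_gt0 cl_gt0 QA gJ gB SL).
  have := superset_gain_le n_gt0 cl_gt0 cu_gt0 c_gt0 bJ (subxx _) QA gJ gB gJ0 gdec
    SL r0 Lr cr r'0 rr'.
  set Z := \sum_i _; lra.
set k := #|_|.
have x1 : expR (- (kap / 2)) < 1 by rewrite expR_lt1 oppr_lt0 divr_gt0.
rewrite [(_ * expR _) ^+ k]exprMn -[leRHS]mulrA.
rewrite ler_wpM2l ?exprn_ge0 ?divr_ge0 ?subr_ge0 ?(ltW x1) //.
rewrite -expRM_natl -expRD ler_expR.
have k1 : 0 < 1 + kap by rewrite addr_gt0.
have K : (1 - 2 * kap) / (1 + kap) * (1 + kap^-1) <= 1 + kap^-1.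
  have ki : 0 < 1 + kap^-1 by rewrite addr_gt0 ?invr_gt0.
  rewrite ger_pMl // ler_pdivrMr // mul1r; lra.
have := ler_wpM2r (ler0n R k) K.
have -> : (1 - kap - kap) / 2 * ((T - (1 + kap^-1) * k%:R) / (1 + kap)) =
  (1 - 2 * kap) / (1 + kap) * (T / 2) -
    (1 - 2 * kap) / (1 + kap) * (1 + kap^-1) * k%:R / 2.
  by field; rewrite !gt_eqF.
lra.
Qed.

End superset_gain.

End exceptional_event.

(** * Estimates at the scale [rho]: exceptional probability and loss of false models *)

Section main_estimates.
Context {R : realType}.
Variables (n p q : nat) (X : 'I_n -> 'cV[R]_p) (b : 'cV[R]_p).
Variables (cl cu c e nu A kap G rho : R).
Let J0 := supp b.
Let lam := ln (p%:R : R).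
Hypotheses (n_gt0 : (0 < n)%N) (p_gt1 : (1 < p)%N) (q_gt0 : (0 < q)%N).
Hypotheses (cl_gt0 : 0 < cl) (cu_gt0 : 0 < cu) (c_gt0 : 0 < c) (nu_gt0 : 0 < nu).
Hypothesis e_itv : 0 < e <= 1.
Hypothesis AE : A = nu + 3 + (cu + 1) / 2.
Hypothesis kapE : kap = e / 32.
Hypothesis QA : forall J : {set 'I_p}, J0 \subset J -> (#|J| <= 2 * q)%N ->
  quad_approx X b J cl cu c.
Hypothesis J0_q : (#|J0| <= q)%N.
Hypotheses (rho_gt0 : 0 < rho) (rho2 : n%:R * rho ^+ 2 = q%:R * lam).
Hypotheses (G_gt0 : 0 < G) (Grho : G * rho <= 1).
Hypothesis Grho3 : G * (n%:R * rho ^+ 3) <= lam.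
Hypotheses (cG : c <= G) (AcG : 16 * A * c <= G * cl ^+ 2).
Hypothesis AckG : 2 * A * c <= G * cl ^+ 2 * kap.
Hypothesis KG : c * (8 * A / cl) ^+ 3 * (1 + (1 + cu / cl) ^+ 3) <= G * e * nu.
Hypothesis p_large :
  3 * (2 / (1 - expR (- (kap / 2))) * expR ((1 + kap^-1) / 2)) <= expR (e * lam / 4).

Let nR : 0 < n%:R :> R. Proof. by rewrite ltr0n. Qed.
Let lam_gt0 : 0 < lam. Proof. by rewrite ln_gt0 // ltr1n. Qed.
Let A_gt0 : 0 < A. Proof. by rewrite AE; move: nu_gt0 cu_gt0; lra. Qed.
Let L := 2 * A * (n%:R * rho).

(** The size [2 * q] leaves room for the union of [J0] with a false model. *)
Definition bounded_score (y : 'I_n -> bool) := forall J : {set 'I_p},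
  J0 \subset J -> (#|J| <= 2 * q)%N -> score_bound X b y J L.

Let B := A * Num.sqrt (n%:R * lam).

(** n rho equals sqrt(n q lam), and the factor 2 in [L] covers the sqrt 2 due to [#|J| <= 2 * q]. *)
Lemma bounded_score_coord (y : 'I_n -> bool) :
  (forall j, `|score X b y j 0| <= B) -> bounded_score y.
Proof.
move=> yB J J0J Jq u uJ.
apply: le_trans (dotp_supported_le uJ (fun j _ => yB j)) _.
rewrite mulrC ler_wpM2r ?norm2_ge0 //.
have L0 : 0 <= L by rewrite !mulr_ge0 ?ltW.
rewrite -[leRHS]ger0_norm // -sqrtr_sqr ler_wsqrtr //.
rewrite /B exprMn sqr_sqrtr ?mulr_ge0 ?(ltW lam_gt0) //.
have -> : L ^+ 2 = 4 * q%:R * (A ^+ 2 * (n%:R * lam)).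
  have -> : L ^+ 2 = 4 * A ^+ 2 * n%:R * (n%:R * rho ^+ 2) by rewrite /L; ring.
  by rewrite rho2; ring.
rewrite ler_wpM2r //; first by rewrite ltW // mulr_gt0 ?exprn_gt0 ?mulr_gt0.
by rewrite -(natrM _ 4 q) ler_nat (leq_trans Jq) // leq_mul2r orbT.
Qed.

(** With step sqrt(lam / n), the term (cu + 1) / 2 of [A] pays for the divergence. Each coordinate
    then costs 2 p^(-nu - 3), and 2 / p^2 <= 1 / 2. *)
Lemma prob_coord_sum_le :
  \sum_(j < p) prob X b [pred y : {ffun 'I_n -> bool} | B < `|score X b y j 0|]
  <= expR (- (nu * lam)) / 2.
Proof.
have pE : p%:R = expR lam :> R by rewrite lnK // posrE ltr0n ltnW.
pose tau := Num.sqrt (lam / n%:R).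
have tau0 : 0 < tau by rewrite sqrtr_gt0 divr_gt0.
have tau2 : n%:R * tau ^+ 2 = lam.
  rewrite sqr_sqrtr; last by rewrite ltW // divr_gt0.
  by rewrite mulrC divfK // gt_eqF.
have tauB : tau * B = A * lam.
  rewrite /B /tau mulrCA -sqrtrM ?divr_ge0 ?(ltW lam_gt0) //.
  have -> : lam / n%:R * (n%:R * lam) = lam ^+ 2 by field; rewrite gt_eqF.
  by rewrite sqrtr_sqr gtr0_norm.
have ctau : c * tau <= 1.
  rewrite (le_trans _ Grho) // ler_pM ?(ltW c_gt0) ?(ltW tau0) //.
  rewrite -(@ler_pXn2r _ 2) ?nnegrE ?(ltW tau0) ?(ltW rho_gt0) //.
  rewrite -(ler_pM2l nR) tau2 rho2 ler_peMl ?(ltW lam_gt0) //.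
  by rewrite ler1n.
have coord j : prob X b [pred y : {ffun 'I_n -> bool} | B < `|score X b y j 0|]
    <= 2 * expR (- ((nu + 3) * lam)).
  have Jq : (#|j |: J0| <= 2 * q)%N.
    rewrite cardsU1 mul2n -addnn; apply: leq_add J0_q.
    by apply: leq_trans q_gt0; case: (_ \notin _).
  apply: le_trans (prob_score_coord_gt B tau0 (QA (finset.subsetUr _ _) Jq)) _.
  rewrite ler_pM2l // ler_expR tauB AE.
  have -> : n%:R * (cu * tau ^+ 2 + c * tau ^+ 3) =
    cu * (n%:R * tau ^+ 2) + c * tau * (n%:R * tau ^+ 2) by ring.
  by rewrite tau2; have := ler_wpM2r (ltW lam_gt0) ctau; lra.
apply: le_trans (ler_sum _ (fun j _ => coord j)) _.
rewrite sumr_const card_ord -[leLHS]mulr_natl pE.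
have -> : - ((nu + 3) * lam) = - (nu * lam) - lam - lam - lam by ring.
rewrite !expRD expRN -!pE.
have p2 : 2 <= p%:R :> R by rewrite ler_nat.
have p0 : 0 < p%:R :> R by rewrite ltr0n ltnW.
have -> : p%:R * (2 * ((expR (nu * lam))^-1 * expR (- lam) * expR (- lam) * expR (- lam)))
  = (expR (nu * lam))^-1 * (2 / p%:R ^+ 2).
  by rewrite expRN -pE; field; rewrite !gt_eqF ?expR_gt0.
rewrite ler_pM2l ?invr_gt0 ?expR_gt0 // ler_pdivrMr ?exprn_gt0 //; nra.
Qed.

Let gain_bound eps (J : {set 'I_p}) := (1 + eps) * (#|J :\: J0|%:R + nu) * lam.

Lemma prob_gain_le eps (J : {set 'I_p}) : e <= eps -> J0 \subset J ->
  (#|J| <= 2 * q)%N ->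
  prob X b [pred y : {ffun 'I_n -> bool} | `[< score_bound X b y J L >] &&
    (gain_bound eps J < maxloglik X y J - maxloglik X y J0)] <=
  expR (- (nu * lam)) * (1 / 3 / #|'I_p|%:R) ^+ #|J :\: J0|.
Proof.
move=> e_eps J0J Jq; set k := #|_ :\: _|.
have /andP[e0 e1] := e_itv.
have pE : p%:R = expR lam :> R by rewrite lnK // posrE ltr0n ltnW.
have kap0 : 0 < kap by rewrite kapE divr_gt0.
have kap1 : kap <= 1 / 32 by rewrite kapE; lra.
(* This [r] gives 4 L = n cl r exactly; [r'] avoids a square root, as x <= (1 + x)^2 for x = cu /
   cl. *)
pose r := 8 * A * rho / cl; pose r' := (1 + cu / cl) * r.
have r0 : 0 < r by rewrite divr_gt0 ?mulr_gt0.
have x0 : 0 < cu / cl by rewrite divr_gt0.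
have L0 : 0 <= L by rewrite ltW // !mulr_gt0.
have Lr : 4 * L <= n%:R * cl * r.
  by rewrite le_eqVlt; apply/orP; left; apply/eqP; rewrite /L /r; field; rewrite gt_eqF.
have cr : c * r <= cl / 2.
  have -> : c * r = 16 * A * c * rho / (2 * cl) by rewrite /r; field; rewrite gt_eqF.
  rewrite ler_pdivrMr ?mulr_gt0 //.
  have := ler_wpM2r (ltW rho_gt0) AcG; have := ler_wpM2l (sqr_ge0 cl) Grho; lra.
have rr' : cu * r ^+ 2 <= cl * r' ^+ 2.
  have -> : cu * r ^+ 2 = cl * r ^+ 2 * (cu / cl) by field; rewrite gt_eqF.
  have -> : cl * r' ^+ 2 = cl * r ^+ 2 * (1 + cu / cl) ^+ 2 by rewrite /r'; ring.
  apply: ler_wpM2l; first by rewrite ltW // mulr_gt0 ?exprn_gt0.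
  by move: (cu / cl) x0 => x x0; nra.
have cLk : c * L / (n%:R * cl ^+ 2) <= kap.
  rewrite ler_pdivrMr ?mulr_gt0 ?exprn_gt0 // /L.
  have nrho := mulr_gt0 nR rho_gt0.
  have := ler_wpM2r (ltW nrho) AckG.
  have nk : 0 <= n%:R * cl ^+ 2 * kap by rewrite !mulr_ge0 ?sqr_ge0 ?ltW.
  have := ler_wpM2l nk Grho; lra.
(* Half of [e] goes into the threshold of the chi-square tail, the other half absorbs the cubic
   errors. *)
pose T := 2 * ((1 + e / 2) * (k%:R + nu) * lam).
have kn0 : 0 <= (k%:R + nu) * lam by rewrite mulr_ge0 ?addr_ge0 ?ler0n ?ltW.
have TM : T / 2 + n%:R * c * (r ^+ 3 + r' ^+ 3) / 2 <= gain_bound eps J.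
  have -> : n%:R * c * (r ^+ 3 + r' ^+ 3) =
    c * (8 * A / cl) ^+ 3 * (1 + (1 + cu / cl) ^+ 3) * (n%:R * rho ^+ 3).
    by rewrite /r' /r; field; rewrite gt_eqF.
  have nr3 : 0 <= n%:R * rho ^+ 3 by rewrite mulr_ge0 ?exprn_ge0 ?ltW.
  have err := ler_wpM2r nr3 KG.
  have enu : 0 <= e * nu by rewrite mulr_ge0 ?ltW.
  have err2 := ler_wpM2l enu Grho3.
  have kl : 0 <= e / 2 * (k%:R * lam) by rewrite !mulr_ge0 ?ler0n ?invr_ge0 ?ltW.
  have M1 := ler_wpM2r kn0 e_eps.
  rewrite /T /gain_bound -/k; lra.
have r'0 : 0 <= r' by rewrite mulr_ge0 ?addr_ge0 ?ltW.
have kap2 : 2 * kap <= 1 by lra.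
apply: le_trans (prob_superset_gain_gt n_gt0 cl_gt0 cu_gt0 c_gt0 J0J (QA J0J Jq)
  L0 r0 Lr cr r'0 rr' kap0 kap2 cLk TM) _.
rewrite -/k; set C := _ * expR ((1 + kap^-1) / 2).
have C0 : 0 <= C.
  by rewrite mulr_ge0 ?expR_ge0 // divr_ge0 // subr_ge0 ltW // expR_lt1 oppr_lt0 divr_gt0.
(* With kap = e / 32, the lattice losses reduce the excess e / 2 to no less than e / 4. *)
have rate : 1 + e / 4 <= (1 - 2 * kap) / (1 + kap) * (1 + e / 2).
  have k1 : 0 < 1 + kap by rewrite addr_gt0.
  rewrite mulrAC ler_pdivlMr // kapE; nra.
have tail : expR (- ((1 - 2 * kap) / (1 + kap) * (T / 2))) <=
    expR (- (nu * lam)) * expR (- (lam + e * lam / 4)) ^+ k.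
  rewrite -expRM_natl -expRD ler_expR.
  have := ler_wpM2r kn0 rate.
  have -> : (1 - 2 * kap) / (1 + kap) * (T / 2) =
    (1 - 2 * kap) / (1 + kap) * (1 + e / 2) * ((k%:R + nu) * lam).
    by rewrite /T; field; rewrite gt_eqF ?addr_gt0.
  have : 0 <= e / 4 * (nu * lam) by rewrite !mulr_ge0 ?invr_ge0 ?ltW.
  lra.
(* Each added coordinate costs C p^(-1 - e / 4), at most 1 / (3 p) by [p_large]. *)
apply: le_trans (ler_wpM2l (exprn_ge0 k C0) tail) _.
rewrite mulrCA -exprMn ler_pM2l ?expR_gt0 //.
apply: lerXn2r; rewrite ?nnegrE ?divr_ge0 ?ler0n //.
  by rewrite mulr_ge0 ?expR_ge0.
rewrite card_ord pE opprD expRD !expRN.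
have := p_large; rewrite -/C => Ce; rewrite mulrCA mulrC ler_pM2r ?invr_gt0 ?expR_gt0 //.
by rewrite ler_pdivrMr ?expR_gt0 //; lra.
Qed.

Definition bounded_gain eps (y : 'I_n -> bool) := forall J : {set 'I_p},
  (#|J| <= q)%N -> J0 \subset J ->
  maxloglik X y J - maxloglik X y J0 <= gain_bound eps J.

(* Union bound over the coordinates of the score and over the models J that
   contain J0 properly. *)
Lemma prob_exceptional_le eps : e <= eps ->
  prob X b [pred y : {ffun 'I_n -> bool} |
    ~~ `[< bounded_score y /\ bounded_gain eps y >]] <= expR (- (nu * lam)).
Proof.
move=> e_eps; have /andP[e0 _] := e_itv.
pose P (i : 'I_p + {set 'I_p}) :=
  if i is inr J then (J0 \proper J) && (#|J| <= q)%N else true.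
pose F (i : 'I_p + {set 'I_p}) : pred {ffun 'I_n -> bool} :=
  match i with
  | inl j => [pred y : {ffun 'I_n -> bool} | B < `|score X b y j 0|]
  | inr J => [pred y : {ffun 'I_n -> bool} | `[< score_bound X b y J L >] &&
      (gain_bound eps J < maxloglik X y J - maxloglik X y J0)]
  end.
have q2 m : (m <= q)%N -> (m <= 2 * q)%N.
  by move=> /leq_trans; apply; rewrite mul2n -addnn leq_addr.
apply: le_trans (@prob_union _ _ _ X b _ P _ F _) _.
  move=> y /= /asboolPn bad; apply: contrapT => nF; apply: bad.
  have yB : bounded_score y.
    apply: bounded_score_coord => j; rewrite leNgt; apply/negP => jB.
    by apply: nF; exists (inl j).
  split=> // J Jq J0J; rewrite leNgt; apply/negP => gain.
  apply: nF; exists (inr J) => /=; last first.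
    by rewrite gain andbT; apply/asboolP; exact: yB J0J (q2 _ Jq).
  (* The model [J0] itself has gain 0, so only proper supersets enter the union bound. *)
  rewrite Jq andbT finset.properEneq J0J andbT; apply: contraTneq gain => <-.
  rewrite subrr -leNgt /gain_bound !mulr_ge0 ?addr_ge0 ?ler0n //;
    rewrite ?(ltW lam_gt0) ?(ltW nu_gt0) //.
  by rewrite ltW // (lt_le_trans e0).
(* Half of the exceptional probability is allotted to the coordinates, half to the models. *)
rewrite big_sumType /= [leRHS](splitr (expR _)) lerD ?prob_coord_sum_le //.
apply: (@le_trans _ _ (\sum_(J : {set 'I_p} | J0 \proper J)
    expR (- (nu * lam)) * (1 / 3 / #|'I_p|%:R) ^+ #|J :\: J0|)).
  rewrite big_mkcond [leRHS]big_mkcond /=; apply: ler_sum => J _.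
  have [J0J|//] := boolP (J0 \proper J); case: ifPn => [/= Jq|_]; last first.
    by rewrite mulr_ge0 ?expR_ge0 ?exprn_ge0 ?divr_ge0.
  by apply: prob_gain_le => //; [exact: proper_sub|exact: q2].
rewrite -mulr_sumr ler_pM2l ?expR_gt0 // -[leRHS]mul1r.
by apply: sum_supersets_le; apply/andP; split; lra.
Qed.

(** Every [beta] in R^J vanishes at [j], so its distance to [b] is at least |b_j| >= sqrt mu; the
    comparison takes place in the model J union J0. *)
Lemma false_model_gap (y : 'I_n -> bool) (ro mu : R) j : bounded_score y ->
  0 < ro <= 1 -> c * ro * 4 <= cl * Num.sqrt cl ->
  0 < mu -> (256 * A ^+ 2 * (q%:R * lam)) <= (cl * ro) ^+ 2 * mu * n%:R ->
  (forall i, i \in J0 -> mu <= b i 0 ^+ 2) -> mu * cl <= 4 ->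
  forall J : {set 'I_p}, (#|J| <= q)%N -> j \in J0 -> j \notin J ->
  cl * ro ^+ 2 / 8 * n%:R * mu <= maxloglik X y J0 - maxloglik X y J.
Proof.
move=> yB /andP[ro0 ro1] cro mu0 nmu mub mucl J Jq jJ0 jJ.
pose r := ro * Num.sqrt mu; have r0 : 0 < r by rewrite mulr_gt0 ?sqrtr_gt0.
have r2 : r ^+ 2 = ro ^+ 2 * mu by rewrite exprMn sqr_sqrtr // ltW.
have -> : cl * ro ^+ 2 / 8 * n%:R * mu = n%:R * cl * r ^+ 2 / 8.
  by rewrite r2; ring.
(* As sqrt(mu cl) <= 2, the product c r sqrt cl is at most 2 c ro, hence at most cl sqrt cl / 2. *)
have cr : c * r <= cl / 2.
  have scl : 0 < Num.sqrt cl by rewrite sqrtr_gt0.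
  have smucl : Num.sqrt mu * Num.sqrt cl <= 2.
    rewrite -sqrtrM ?(ltW mu0) // -[leRHS]ger0_norm // -sqrtr_sqr ler_wsqrtr //.
    by rewrite expr2 -natrM.
  rewrite ler_pdivlMr // -(ler_pM2r scl).
  have := ler_wpM2r (sqrtr_ge0 mu) cro.
  have := ler_wpM2l (ltW cl_gt0) smucl; rewrite /r; nra.
have Lr : 8 * L <= n%:R * cl * r.
  have L0 : 0 <= 8 * L by rewrite ltW // !mulr_gt0.
  have ncr := ltW (mulr_gt0 (mulr_gt0 nR cl_gt0) r0).
  rewrite -(@ler_pXn2r _ 2) ?nnegrE //.
  have -> : (8 * L) ^+ 2 = n%:R * (256 * A ^+ 2 * (n%:R * rho ^+ 2)).
    by rewrite /L; ring.
  rewrite rho2 [leRHS]exprMn r2 exprMn.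
  have -> : n%:R ^+ 2 * cl ^+ 2 * (ro ^+ 2 * mu) = n%:R * ((cl * ro) ^+ 2 * mu * n%:R).
    by ring.
  by rewrite ler_pM2l.
rewrite lerBrDl -lerBrDr; apply: maxloglik_le => beta betaJ.
pose J' := J :|: J0.
have J'q : (#|J'| <= 2 * q)%N.
  by rewrite mul2n -addnn (leq_trans (leq_card_setU _ _)) // leq_add.
have J0J' : J0 \subset J' by exact: finset.subsetUr.
have bJ0 : supported J0 b by exact: subxx.
have bJ' : supported J' b := supportedS J0J' bJ0.
have uJ' : supported J' (beta - b).
  by apply: supportedB => //; apply: supportedS betaJ; exact: finset.subsetUl.
have ru : r <= norm2 (beta - b).
  apply: le_trans (norm2_coord _ j); rewrite !mxE.
  move/supportedP : betaJ => /(_ j jJ) ->; rewrite sub0r normrN.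
  rewrite -(@ler_pXn2r _ 2) ?nnegrE ?(ltW r0) // real_normK ?num_real //.
  by rewrite r2 (le_trans _ (mub j jJ0)) // ler_piMl ?(ltW mu0) // expr_le1 // ltW.
have := false_model_loss_ge n_gt0 cl_gt0 (QA J0J' J'q) (yB _ J0J' J'q) uJ'
  r0 ru cr Lr.
rewrite addrC subrK => /le_trans; apply.
by have := maxloglik_ge X y bJ0; lra.
Qed.
End main_estimates.

(** * The law of the responses *)

Section response_law.
Context {R : realType}.
Variables (n p : nat) (X : 'I_n -> 'cV[R]_p) (b : 'cV[R]_p).
Variables (d : measure_display) (T : measurableType d) (P : probability T R).
Variable Y : 'I_n -> {RV P >-> bool}.
Hypothesis model : logistic_model X b Y.

Let atom (y : {ffun 'I_n -> bool}) : set T :=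
  \bigcap_(i in [set: 'I_n]) (Y i @^-1` [set y i]).

Lemma response_prob i (s : bool) : P (Y i @^-1` [set s]) =
  (expR (s%:R * dotp (X i) b - cumulant (dotp (X i) b)))%:E.
Proof.
have [_ /(_ i)[]] := model; rewrite /success_prob; set t := dotp (X i) b.
have mY : measurable (Y i @^-1` [set true]) by exact: measurable_funPTI.
have PE := fineK (fin_num_measure P _ mY); move: PE.
set s1 := fine _ => PE /andP[s0 s1_lt1] logit.
have s1n : 0 < 1 - s1 by rewrite subr_gt0.
have eE : expR t = s1 / (1 - s1) by rewrite -logit lnK // posrE divr_gt0.
have e1 : 1 + expR t = (1 - s1)^-1 by rewrite eE; field; rewrite gt_eqF.
rewrite expRD expRN lnK ?posrE ?expRD1_gt0 // e1 invrK.
case: s; rewrite ?mul1r ?mul0r ?expR0 ?mul1r.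
  by rewrite -PE eE divfK // gt_eqF.
have -> : Y i @^-1` [set false] = ~` (Y i @^-1` [set true]).
  by apply/seteqP; split => w /=; case: (Y i w).
by rewrite probability_setC // -PE.
Qed.

Lemma atom_prob y : P (atom y) = (expR (loglik X y b))%:E.
Proof.
have [indep _] := model; rewrite /atom (indep (fun i => [set y i])).
under eq_bigr => i _ do rewrite response_prob.
by rewrite prodEFin -expR_sum.
Qed.

(** The event is a finite disjoint union of atoms, so it is measurable whatever the predicate. *)
Lemma responses_prob (A : pred {ffun 'I_n -> bool}) :
  P [set w | A [ffun i => Y i w]] = (prob X b A)%:E.
Proof.
have -> : [set w | A [ffun i => Y i w]] = \bigcup_(y in [set` enum A]) atom y.
  apply/seteqP; split => w /=.
    move=> Aw; exists [ffun i => Y i w]; first by rewrite /= mem_enum.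
    by move=> i _ /=; rewrite ffunE.
  move=> [y /=]; rewrite mem_enum => Ay yw.
  suff -> : [ffun i => Y i w] = y by [].
  by apply/ffunP => i; rewrite ffunE; exact: yw.
rewrite measure_fin_bigcup.
- rewrite -fsbig_seq ?enum_uniq // big_enum /= /prob -sumEFin.
  by apply: eq_bigr => y _; rewrite atom_prob.
- exact: finite_seq.
- move=> y z _ _ [w [yw zw]]; apply/ffunP => i.
  by have /= <- := yw i I; exact: zw.
- move=> y _; apply: fin_bigcap_measurable => // i _.
  exact: measurable_funPTI.
Qed.

End response_law.

(* The four constants are chosen after the values c_change, cl = c_lower a0 and
   cu = c_upper a0 (and eps, nu), but before a0, c_lower and c_upper. *)
Theorem theorem2p2 (R : realType) (eps nu c_change cl cu : R)
    (eps_gt0 : 0 < eps) (nu_gt0 : 0 < nu) (c_change_gt0 : 0 < c_change)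
    (cl_gt0 : 0 < cl) (cu_gt0 : 0 < cu) :
  exists C_false C_dim C_sample1 C_sample2 : R,
    [/\ 0 < C_false, 0 < C_dim, 0 < C_sample1 & 0 < C_sample2] /\
    forall (a0 : R) (c_lower c_upper : R -> R),
      0 < a0 ->
      (forall t, 0 <= t -> 0 < c_lower t) ->
      (forall t, 0 <= t -> 0 < c_upper t) ->
      (forall s t, 0 <= s -> s <= t -> c_lower t <= c_lower s) ->
      (forall s t, 0 <= s -> s <= t -> c_upper s <= c_upper t) ->
      c_lower a0 = cl -> c_upper a0 = cu ->
    forall (n p q : nat), (2 <= n)%N -> (2 <= p)%N -> (1 <= q)%N ->
    forall (beta0 : 'cV[R]_p) (X : 'I_n -> 'cV[R]_p)
      (d : measure_display) (T : measurableType d) (P : probability T R)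
      (Y : 'I_n -> {RV P >-> bool}),
      let J0 := supp beta0 in
      (#|J0| <= q)%N ->
      norm2 beta0 <= a0 ->
      hessian_conditions X q J0 c_lower c_upper c_change ->
      logistic_model X beta0 Y ->
      C_dim <= p%:R ->
      (maxe (C_sample1 * q%:R ^+ 3 * ln p%:R)%:E
            ((C_sample2 * (q%:R * ln p%:R))%:E / min_signal beta0)
        <= n%:R%:E)%E ->
      let L w := maxloglik X (fun i => Y i w) in
      ((1 - p%:R `^ (- nu))%:E <= P [set w |
        (forall J : {set 'I_p}, (#|J| <= q)%N -> J0 \subset J ->
           (L w J - L w J0 <= (1 + eps) * (#|J :\: J0|%:R + nu) * ln p%:R)%R)
        /\
        (forall J : {set 'I_p}, (#|J| <= q)%N -> ~~ (J0 \subset J) ->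
           ((C_false * n%:R)%:E * min_signal beta0
              <= (L w J0 - L w J)%:E)%E)])%E.
Proof.
(* The numerical estimates need [e <= 1]; the gain bound only weakens as [eps] grows. *)
pose e := Num.min eps 1.
have e_itv : 0 < e <= 1 by rewrite lt_min eps_gt0 ltr01 ge_min lexx orbT.
have e_eps : e <= eps by rewrite ge_min lexx.
have /andP[e0 e1] := e_itv.
pose kap := e / 32; have kap0 : 0 < kap by rewrite divr_gt0.
pose A := nu + 3 + (cu + 1) / 2.
have A0 : 0 < A by rewrite /A; lra.
pose C := 2 / (1 - expR (- (kap / 2))) * expR ((1 + kap^-1) / 2).
have C0 : 0 < C.
  by rewrite mulr_gt0 ?expR_gt0 // divr_gt0 // subr_gt0 expR_lt1 oppr_lt0 divr_gt0.
have c0 := c_change_gt0; set c := c_change in c0 *.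
pose K := c * (8 * A / cl) ^+ 3 * (1 + (1 + cu / cl) ^+ 3).
have x0 : 0 < cu / cl by rewrite divr_gt0.
have K0 : 0 < K.
  rewrite mulr_gt0 ?addr_gt0 ?exprn_gt0 ?addr_gt0 // mulr_gt0 // exprn_gt0 //.
  by rewrite divr_gt0 ?mulr_gt0.
(* [G] is the sum of all the lower bounds imposed on it. *)
have [G [G0 cG AcG AckG KG]] : exists G, [/\ 0 < G, c <= G,
    16 * A * c <= G * cl ^+ 2, 2 * A * c <= G * cl ^+ 2 * kap & K <= G * e * nu].
  have G1 : 0 < 16 * A * c / cl ^+ 2 by rewrite divr_gt0 ?exprn_gt0 // !mulr_gt0.
  have G2 : 0 < 2 * A * c / (cl ^+ 2 * kap).
    by rewrite divr_gt0 ?mulr_gt0 ?exprn_gt0.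
  have G3 : 0 < K / (e * nu) by rewrite divr_gt0 // mulr_gt0.
  exists (c + 16 * A * c / cl ^+ 2 + 2 * A * c / (cl ^+ 2 * kap) + K / (e * nu)).
  split; first by lra.
  - by lra.
  - by rewrite -ler_pdivrMr ?exprn_gt0 //; lra.
  - by rewrite -[leRHS]mulrA -ler_pdivrMr ?mulr_gt0 ?exprn_gt0 //; lra.
  - by rewrite -[leRHS]mulrA -ler_pdivrMr ?mulr_gt0 //; lra.
pose s := cl * Num.sqrt cl; have s0 : 0 < s by rewrite mulr_gt0 ?sqrtr_gt0.
(* A ratio that is at most 1 and also satisfies 4 c ro <= s. *)
pose ro := s / (s + 4 * c).
have sc0 : 0 < s + 4 * c by rewrite addr_gt0 // mulr_gt0.
have ro01 : 0 < ro <= 1.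
  by rewrite divr_gt0 //= ler_pdivrMr // mul1r lerDl mulr_ge0 // ltW.
have cro : c * ro * 4 <= s.
  have -> : c * ro * 4 = s * ((4 * c) / (s + 4 * c)).
    by rewrite /ro; field; rewrite gt_eqF.
  by rewrite ger_pMr // ler_pdivrMr // mul1r lerDr ltW.
have /andP[ro0 ro1] := ro01.
clearbody ro.
(* The second constant makes p^(e/4) at least 3 C; the last one yields 8 L <= n cl r, since 64 L^2 =
   256 A^2 n q lam. *)
exists (cl * ro ^+ 2 / 8), (expR (4 / e * ln (3 * C))), (G ^+ 2),
  (256 * A ^+ 2 / (cl * ro) ^+ 2); split.
  split; [|exact: expR_gt0|exact: exprn_gt0|].
    by rewrite divr_gt0 // mulr_gt0 // exprn_gt0.
  apply: divr_gt0; last exact/exprn_gt0/mulr_gt0.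
  by apply: mulr_gt0; [rewrite ltr0n|exact: exprn_gt0].
move=> a0 c_lower c_upper a00 _ _ ldec uinc clE cuE n p q n2 p2 q1 b X d T P Y J0
  J0q ba HC model Cp nC; cbv beta zeta.
have n0 : (0 < n)%N := ltnW n2.
have nR : 0 < n%:R :> R by rewrite ltr0n.
have p0 : 0 < p%:R :> R by rewrite ltr0n ltnW.
pose lam : R := ln p%:R; have lam0 : 0 < lam by rewrite ln_gt0 // ltr1n.
have QA (J : {set 'I_p}) : J0 \subset J -> (#|J| <= 2 * q)%N ->
    quad_approx X b J cl cu c.
  move=> J0J Jq; rewrite -clE -cuE.
  exact: (quad_approx_of_conditions n0 (ltW c0) ldec uinc HC ba J0J Jq).
have p_large : 3 * C <= expR (e * lam / 4).
  have C3 : 0 < 3 * C by rewrite mulr_gt0.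
  rewrite -[leLHS]lnK ?posrE // ler_expR.
  have : 4 / e * ln (3 * C) <= lam.
    by rewrite -ler_expR lnK // posrE.
  by rewrite mulrAC ler_pdivrMr //; lra.
move: nC; rewrite ge_max => /andP[]; rewrite lee_fin => nG nS.
have [rho [rho0 Grho rho2 Grho3]] := sample_scale n0 q1 lam0 G0 nG.
have E := prob_exceptional_le n0 p2 q1 cl_gt0 cu_gt0 c0 nu_gt0 e_itv erefl erefl
  QA J0q rho0 rho2 Grho Grho3 cG AcG AckG KG p_large e_eps.
have pnu : p%:R `^ (- nu) = expR (- (nu * lam)).
  by rewrite /powR gt_eqF // mulNr.
pose good (y : 'I_n -> bool) :=
  bounded_score q X b A rho y /\ bounded_gain q X b nu eps y.
pose goal (y : 'I_n -> bool) :=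
  (forall J : {set 'I_p}, (#|J| <= q)%N -> J0 \subset J ->
     maxloglik X y J - maxloglik X y J0 <= (1 + eps) * (#|J :\: J0|%:R + nu) * lam)
  /\
  (forall J : {set 'I_p}, (#|J| <= q)%N -> ~~ (J0 \subset J) ->
     ((cl * ro ^+ 2 / 8 * n%:R)%:E * min_signal b
        <= (maxloglik X y J0 - maxloglik X y J)%:E)%E).
have good_goal y : good y -> goal y.
  move=> [yB yG]; split=> // J Jq /fintype.subsetPn[j jJ0 jJ].
  (* A model missing some [j] of [J0] shows that [J0] is nonempty, so the minimal signal is a real
     number. *)
  have [i [ib mE imin]] := min_signalE jJ0.
  rewrite mE -EFinM lee_fin.
  have mu0 : 0 < b i 0 ^+ 2 by rewrite exprn_even_gt0 //=; move: ib; rewrite inE.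
  apply: (false_model_gap n0 cl_gt0 cu_gt0 nu_gt0 erefl QA J0q rho0 rho2 yB ro01
    cro mu0 _ _ _ Jq jJ0 jJ) => //.
    move: nS; rewrite mE inver gt_eqF // -EFinM lee_fin ler_pdivrMr // => nS.
    move: nS (exprn_gt0 2 (mulr_gt0 cl_gt0 ro0)); rewrite -/lam.
    move: ((cl * ro) ^+ 2) => D nS D0; have := ler_wpM2l (ltW D0) nS.
    have -> : D * (256 * A ^+ 2 / D * (q%:R * lam)) = 256 * A ^+ 2 * (q%:R * lam).
      by field; rewrite gt_eqF.
    by move/le_trans; apply; rewrite mulrA mulrAC.
  (* mu cl <= cl |b|^2, which is at most the Hessian form of [b] at [b] divided by n, hence at most
     4. *)
  have J0q2 : (#|J0| <= 2 * q)%N by rewrite (leq_trans J0q) // leq_pmull.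
  have [Ql _ _] := QA J0 (subxx _) J0q2 b (subxx _).
  have := le_trans Ql (hess_self_le X b); rewrite -mulrA mulrC ler_pM2r // => clb.
  apply: le_trans clb; rewrite mulrC ler_pM2l // -real_normK ?num_real //.
  by rewrite lerXn2r ?nnegrE ?norm2_ge0 ?norm2_coord.
suff : ((1 - p%:R `^ (- nu))%:E <= P [set w | goal (fun i => Y i w)])%E by [].
have -> : [set w | goal (fun i => Y i w)] =
    [set w | [pred y : {ffun 'I_n -> bool} | `[< goal y >]] [ffun i => Y i w]].
  apply/seteqP; split => w /=;
    have -> : [ffun i => Y i w] = (fun i => Y i w) :> ('I_n -> bool)
      by apply/funext => i; rewrite ffunE.
    by move=> ?; apply/asboolP.
  by move=> /asboolP.
rewrite (responses_prob model) lee_fin pnu.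
apply: (@le_trans _ _ (prob X b [pred y : {ffun 'I_n -> bool} | `[< good y >]])).
  by rewrite probC lerD2l lerN2.
by apply: prob_subset => y /asboolP/good_goal ?; apply/asboolP.
Qed.
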